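(* Let $n\in\mathbb N$. For any $K\ge1$, $0<\gamma<1$ and $\eta>0$ there exists $m_0\in\mathbb{N}$ such that the following is true. Suppose that $m\ge m_0$, $R_0>0$ and $G\subset C\subset X\subset\ell_\infty$ are closed sets such that $(X,C,G)$ satisfies $GTA(\eta,K,4^{-m},R_0)$. Then for any $x\in G$ and $0<r\le R_0$, there exists a $\gamma$-Hölder map $$\iota\colon[0,r]^n\subset\ell_\infty^n\to B(x,20Kr)\subset\ell_\infty$$ with $\iota(0)=x$ such that: (1) $\iota|_{\mathcal{D}(r,m)}\colon\mathcal{D}(r,m)\to C$ is $(K+2^{-m})$-bi-Lipschitz onto its image; (2) for any $y,z\in[0,r]^n$ with $\|y-z\|_\infty\le2^{-m}r$, $\|\iota(y)-\iota(z)\|_\infty\le10K2^{-m\gamma/2}r$; (3) $\mathcal{H}^n_\infty(\iota([0,r]^n)\setminus C)\le\Lambda\,\mathcal{H}^n(B(\iota(0),20Kr)\cap X\setminus G)$, for some $\Lambda>0$ depending only upon $K,\gamma,m,n,\eta$.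
   Context: $\ell_\infty$ is the Banach space of bounded real sequences with the supremum norm, $\ell^n_\infty=(\mathbb{R}^n,\|\cdot\|_\infty)$; $B(x,r)$ is the closed ball. $\mathcal{D}(R,m)=\{R2^{-m}(j_1,\dots,j_n)\in[0,R]^n: j_1,\dots,j_n\in\mathbb{Z}\}$. A map is $L$-bi-Lipschitz onto its image if it is $L$-Lipschitz and invertible onto its image with $L$-Lipschitz inverse. $\mathcal{H}^n_\delta(A)=\inf\{\sum_i\operatorname{diam}(A_i)^n: A\subset\bigcup_{i\in\mathbb N} A_i,\operatorname{diam}(A_i)\le\delta\}$ for $0<\delta\le\infty$; $\mathcal{H}^n=\lim_{\delta\to0}\mathcal{H}^n_\delta$ is Hausdorff measure and $\mathcal{H}^n_\infty$ is Hausdorff content. Pointed Gromov–Hausdorff distance: for a metric space $Z$, $z\in Z$ and $A,B\subset Z$, $H_z(A,B)$ is the infimum of all $0<\epsilon<1/2$ such that every point of $A\cap B(z,1/\epsilon)$ is at distance at most $\epsilon$ from $B$ and every point of $B\cap B(z,1/\epsilon)$ is at distance at most $\epsilon$ from $A$ (and $1/2$ if there is no such $\epsilon$). $d_{pGH}((X,x),(Y,y))$ is the infimum of $H_z(X,Y)$ over all pointed metric spaces $(Z,z)$ and isometric embeddings of $X,Y$ into $Z$ mapping $x$ and $y$ to $z$. For $K\ge1$, $\mathrm{biLip}(K)$ is the set of isometry classes of pointed proper metric spaces $(Y,y)$ for which there is a surjective $K$-bi-Lipschitz map $\ell_\infty^n\to Y$; $d_{pGH}(\cdot,\mathrm{biLip}(K))$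 denotes the infimum of the distances to its elements. Good tangential approximation: let $(X,d)$ be a complete metric space, $G\subset C\subset X$ closed, $K\ge1$, $\eta,R_0>0$, $0<\delta<1/2$. $(X,C,G)$ satisfies $GTA(\eta,K,\delta,R_0)$ if: (i) for each $x\in C$ and $0<r\le R_0$, $\mathcal{H}^n(B(x,r))\ge\eta r^n$ (ball in $X$); (ii) for each $x\in G$ and $0<r\le R_0$ there is a closed $C'\subset C$ containing $x$ with $\mathcal{H}^n(B(x,r)\setminus C')<\eta(\delta r)^n$ and $$d_{pGH}\big((C',d/r,x),\mathrm{biLip}(K)\big)<\min\Big\{\delta,\frac1{K(1+2\delta)}\Big\}.$$ In the claim $X\subset\ell_\infty$ carries the metric of $\ell_\infty$. *)

(* Defs.v *)
From HB Require Import structures.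
From mathcomp Require Import all_boot all_order all_algebra.
From mathcomp Require Import all_classical all_reals all_analysis.

Set Implicit Arguments.
Unset Strict Implicit.
Unset Printing Implicit Defensive.

Import Order.TTheory GRing.Theory Num.Theory.
Import numFieldNormedType.Exports.

Local Open Scope classical_set_scope.
Local Open Scope ring_scope.

(* The Banach space [ell_infty R] of bounded real sequences, normed by
   [sup_i |u i|]. *)
Definition bounded_seq (R : realType) : {pred nat -> R} :=
  [pred u | `[< exists M : R, forall i, `|u i| <= M >]].

Record ell_infty (R : realType) := EllInfty {
  ell_seq :> nat -> R;
  ell_bounded : ell_seq \in @bounded_seq R }.

HB.instance Definition _ (R : realType) := [isSub for @ell_seq R].
HB.instance Definition _ (R : realType) := [Choice of ell_infty R by <:].

Section ell_infty_normed.
Context {R : realType}.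
Implicit Types u v : ell_infty R.

Lemma bounded_seq_submod_closed : submod_closed (@bounded_seq R).
Proof.
split=> [|a u v /asboolP[M uM] /asboolP[N vN]].
  by apply/asboolP; exists 0 => i; rewrite normr0.
apply/asboolP; exists (`|a| * M + N) => i.
rewrite (le_trans (ler_normD _ _))// lerD// normrM.
by rewrite ler_wpM2l.
Qed.

HB.instance Definition _ := GRing.isSubmodClosed.Build R (nat -> R)
  (@bounded_seq R) bounded_seq_submod_closed.

HB.instance Definition _ := [SubChoice_isSubLmodule of ell_infty R by <:].

Definition sup_norm u : R := sup (range (fun i => `|u i|)).

Lemma sup_norm_ub u i : `|u i| <= sup_norm u.
Proof.
have /asboolP[M uM] := ell_bounded u.
apply: ub_le_sup; last by exists i.
by exists M => _ [j _ <-].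
Qed.

Lemma sup_norm_le u M : (forall i, `|u i| <= M) -> sup_norm u <= M.
Proof.
move=> uM; apply: ge_sup; first by exists `|u 0%N|; exists 0%N.
by move=> _ [i _ <-].
Qed.

Lemma sup_normD u v : sup_norm (u + v) <= sup_norm u + sup_norm v.
Proof.
apply: sup_norm_le => i; rewrite (le_trans (ler_normD _ _))//.
by rewrite lerD ?sup_norm_ub.
Qed.

Lemma sup_normZ (a : R) u : sup_norm (a *: u) = `|a| * sup_norm u.
Proof.
have le b w : sup_norm (b *: w) <= `|b| * sup_norm w.
  by apply: sup_norm_le => i; rewrite normrM ler_wpM2l ?sup_norm_ub.
apply/eqP; rewrite eq_le le /=.
have [->|a0] := eqVneq a 0.
  by rewrite normr0 mul0r (le_trans _ (sup_norm_ub _ 0%N)).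
rewrite -ler_pdivlMl ?normr_gt0// -normfV.
by rewrite (le_trans _ (le _ _))// scalerA mulVf// scale1r.
Qed.

Lemma sup_norm_eq0 u : sup_norm u = 0 -> u = 0.
Proof.
move=> u0; apply/val_inj/funext => i; apply/eqP.
by rewrite -normr_le0 -u0 sup_norm_ub.
Qed.

HB.instance Definition _ := @Lmodule_isNormed.Build R (ell_infty R)
  sup_norm sup_normD sup_normZ sup_norm_eq0.

End ell_infty_normed.

(* The distance of a normed space, for the two spaces considered here. *)
Section norm_metric.
Context {R : realType} (V : normedModType R).

Definition norm_dist (x y : V) : R := `|y - x|.

Lemma norm_dist_ge0 x y : 0 <= norm_dist x y.
Proof. exact: normr_ge0. Qed.

Lemma norm_dist_positivity x y : norm_dist x y = 0 -> x = y.
Proof. by move/normr0_eq0/eqP; rewrite subr_eq0 => /eqP. Qed.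

Lemma ball_norm_dist x d : ball x d = [set y | norm_dist x y < d].
Proof. by rewrite -ball_normE; apply/seteqP; split=> y; rewrite /= distrC. Qed.

End norm_metric.

HB.instance Definition _ (R : realType) :=
  PseudoMetric_isMetric.Build R (ell_infty R)
    (@norm_dist_ge0 R (ell_infty R))
    (@norm_dist_positivity R (ell_infty R))
    (@ball_norm_dist R (ell_infty R)).

(* [ell_infty^n] is ['rV[R]_n], whose library norm is the maximum norm. *)
HB.instance Definition _ (R : realType) (m n : nat) :=
  PseudoMetric_isMetric.Build R 'M[R]_(m, n)
    (@norm_dist_ge0 R 'M[R]_(m, n))
    (@norm_dist_positivity R 'M[R]_(m, n))
    (@ball_norm_dist R 'M[R]_(m, n)).

Section metric_notions.
Context {R : realType}.

(* Not the library's [closed_ball], which is the closure of the open ball. *)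
Definition cball (T : metricType R) (x : T) (r : R) : set T :=
  [set y | mdist x y <= r].

Definition proper_metric (T : metricType R) :=
  forall (x : T) (r : R), compact (cball x r).

Definition complete_set (T : metricType R) (A : set T) :=
  forall F : set_system T, ProperFilter F -> F A -> cauchy F ->
    exists2 x, A x & F --> x.

Definition lipschitz_map (T U : metricType R) (L : R) (A : set T)
    (f : T -> U) :=
  forall x y, A x -> A y -> mdist (f x) (f y) <= L * mdist x y.

Definition bilipschitz_map (T U : metricType R) (L : R) (A : set T)
    (f : T -> U) :=
  lipschitz_map L A f /\
  exists g : U -> T, (forall x, A x -> g (f x) = x) /\
    lipschitz_map L (f @` A) g.

Definition hoelder_map (T U : metricType R) (gamma : R) (A : set T)
    (f : T -> U) :=
  exists L : R, forall x y, A x -> A y ->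
    mdist (f x) (f y) <= L * mdist x y `^ gamma.

Definition isometric_embedding (T U : metricType R) (f : T -> U) :=
  forall x y, mdist (f x) (f y) = mdist x y.

End metric_notions.

Section hausdorff.
Context {R : realType} {T : metricType R}.
Local Open Scope ereal_scope.

(* The element [0] only serves to give [diam set0 = 0]. *)
Definition diam (A : set T) : \bar R :=
  ereal_sup (0 |` [set (mdist x y)%:E | x in A & y in A]).

(* Meant for [n > 0]: since [x ^+ 0 = 1], all these sums are [+oo] for [n = 0]. *)
Definition hausdorff_delta (n : nat) (delta : \bar R) (A : set T) : \bar R :=
  ereal_inf [set \sum_(i <oo) diam (F i) ^+ n |
    F in [set F : nat -> set T | A `<=` \bigcup_i F i /\
                                 forall i, diam (F i) <= delta]].

Definition hausdorff_measure (n : nat) (A : set T) : \bar R :=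
  lim (hausdorff_delta n d%:E A @[d --> (0 : R)^'+]).

Definition hausdorff_content (n : nat) (A : set T) : \bar R :=
  hausdorff_delta n +oo A.

End hausdorff.

(* The set [A] with the metric [d / r], where [d] is the metric of [T]. *)
Definition scaled_subspace (R : realType) (T : metricType R) (A : set T)
  (r : {posnum R}) : Type := {x : T | x \in A}.

Section scaled_subspace.
Context {R : realType} {T : metricType R} (A : set T) (r : {posnum R}).

HB.instance Definition _ := Choice.on (scaled_subspace A r).

Definition scaled_dist (x y : scaled_subspace A r) : R :=
  mdist (sval x) (sval y) / r%:num.

Lemma scaled_distxx x : scaled_dist x x = 0.
Proof. by rewrite /scaled_dist mdistxx mul0r. Qed.

Lemma scaled_dist_positivity x y : scaled_dist x y = 0 -> x = y.
Proof.
move/eqP; rewrite mulf_eq0 => /orP[/eqP/mdist_positivity/val_inj //|].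
by rewrite invr_eq0 gt_eqF.
Qed.

Lemma scaled_dist_sym x y : scaled_dist x y = scaled_dist y x.
Proof. by rewrite /scaled_dist metric_sym. Qed.

Lemma scaled_dist_triangle y x z :
  scaled_dist x z <= scaled_dist x y + scaled_dist y z.
Proof. by rewrite -mulrDl ler_pM2r ?metric_triangle. Qed.

HB.instance Definition _ := isMetric.Build R (scaled_subspace A r)
  scaled_distxx scaled_dist_positivity scaled_dist_sym scaled_dist_triangle.

Definition scaled_point (x : T) (Ax : A x) : scaled_subspace A r :=
  exist _ x (mem_set Ax).

End scaled_subspace.

Section gromov_hausdorff.
Context {R : realType}.

Definition pH_admissible (Z : metricType R) (z : Z) (A B : set Z) : set R :=
  [set e | [/\ 0 < e < 2^-1,
    forall a, A a -> cball z e^-1 a -> (edist_inf B a <= e%:E)%E &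
    forall b, B b -> cball z e^-1 b -> (edist_inf A b <= e%:E)%E]].

Definition pH (Z : metricType R) (z : Z) (A B : set Z) : R :=
  if pH_admissible z A B == set0 then 2^-1 else inf (pH_admissible z A B).

Definition dpGH (X Y : metricType R) (x : X) (y : Y) : \bar R :=
  ereal_inf [set e | exists (Z : metricType R) (z : Z) (f : X -> Z) (g : Y -> Z),
    [/\ isometric_embedding f, isometric_embedding g, f x = z, g y = z &
        e = (pH z (range f) (range g))%:E]].

(* Membership in biLip(K), for a representative [(Y, y)] of an isometry class;
   [dpGH] only depends on isometry classes. *)
Definition biLip (n : nat) (K : R) (Y : metricType R) (y : Y) :=
  proper_metric Y /\
  exists f : 'rV[R]_n -> Y, range f = setT /\ bilipschitz_map K setT f.

Definition dpGH_biLip (n : nat) (K : R) (X : metricType R) (x : X) : \bar R :=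
  ereal_inf [set e | exists (Y : metricType R) (y : Y),
    biLip n K y /\ e = dpGH x y].

End gromov_hausdorff.

(* Good tangential approximation of [(X, C, G)], where [X] is a subset of [T]
   with the induced metric: the balls of [X] are the sets [cball x r `&` X],
   and Hausdorff measure is the same in [X] as in [T]. *)
Record GTA (R : realType) (T : metricType R) (n : nat)
    (eta K delta R0 : R) (X C G : set T) : Prop := {
  GTA_complete : complete_set X;
  GTA_closedC : closed C;
  GTA_closedG : closed G;
  GTA_subGC : G `<=` C;
  GTA_subCX : C `<=` X;
  GTA_K : 1 <= K;
  GTA_eta : 0 < eta;
  GTA_R0 : 0 < R0;
  GTA_delta : 0 < delta < 2^-1;
  GTA_lower_regular : forall (x : T) (r : R), C x -> 0 < r <= R0 ->
    ((eta * r ^+ n)%:E <= hausdorff_measure n (cball x r `&` X))%E;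
  GTA_tangent : forall (x : T) (r : {posnum R}), G x -> r%:num <= R0 ->
    exists (C' : set T) (C'x : C' x),
      [/\ closed C', C' `<=` C,
          (hausdorff_measure n ((cball x r%:num `&` X) `\` C')
             < (eta * (delta * r%:num) ^+ n)%:E)%E &
          (dpGH_biLip n K (scaled_point r C'x)
             < (Num.min delta (K * (1 + 2 * delta))^-1)%:E)%E] }.

Section cube.
Context {R : realType} {n : nat}.

Definition cube (r : R) : set 'rV[R]_n :=
  [set x | forall i, 0 <= x ord0 i <= r].

Definition dyadic_grid (r : R) (m : nat) : set 'rV[R]_n :=
  [set x | cube r x /\
    exists j : 'I_n -> int, forall i, x ord0 i = r * 2 ^- m * (j i)%:~R].

End cube.

(* Main.v *)
Require Import Defs.
From mathcomp Require Import all_boot all_order all_algebra.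
From mathcomp Require Import all_classical all_reals all_analysis.
From mathcomp Require Import ring lra.

Set Implicit Arguments.
Unset Strict Implicit.
Unset Printing Implicit Defensive.

Import Order.TTheory GRing.Theory Num.Theory.
Import numFieldNormedType.Exports.

Local Open Scope classical_set_scope.
Local Open Scope ring_scope.

(** Near a point [g] of [G], at scale [rho], the set [C] is [delta rho]-close to
    a [K]-bi-Lipschitz copy of [R^n]: the small measure of the complement of
    [C'], against the lower regularity at points of [C], forces every point of
    [C] near [g] to be close to [C'].  Since [R] is injective, McShane
    extensions of a discretised chart and of its inverse compose to a Lipschitz
    map [P] of [ell_infty] which sends a whole ball around [g] to within
    [O(delta rho)] of [C] and moves the points of [C] in this ball by
    [O(delta rho)] only.

    Start from a map [h 0] given by a chart on the grid [D(r, m)].  Given [h k],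
    which is [L_k]-Lipschitz, let [s_k = 2^(-m(k+1)) r] and [t_k = L_k s_k].
    Apply such retractions [P] in turn on balls of radius [s_k] of the domain,
    with cutoffs, wherever [h k] is [O(t_k)]-close to [G].  The balls are
    coloured with [2^n] colours, so that balls of one colour do not interact,
    and a later colour does little harm where an earlier one has already brought
    the map close to [C].  Another cutoff keeps the map fixed on [D(r, m)].  The
    result [h (k+1)] is [b L_k]-Lipschitz for a constant [b] depending on [K] and
    [n] only, so that [t_k] decays like [(b 2^-m)^k], and the limit is
    [gamma]-Hoelder as soon as [b 2^-m <= 2^(-m gamma)].

    If [iota y] is not in [C], at some first stage [k] the point [h k y] is far
    from [G] relative to [t_k], while still within [t_k] of a point [c] of [C].
    The ball of radius [t_k] around [c] misses [G] and has measure at least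
    [eta t_k^n] in [X]; (3) follows by Vitali covering. *)

(** * Lipschitz extension *)

Section ell_infty_coord.
Context {R : realType}.
Implicit Types u v : ell_infty R.

Lemma ellBE u v i : (u - v) i = u i - v i. Proof. by []. Qed.

Lemma ell_coord_le u i : `|u i| <= `|u|.
Proof. exact: sup_norm_ub. Qed.

Lemma ell_norm_le u (M : R) : (forall i, `|u i| <= M) -> `|u| <= M.
Proof. exact: sup_norm_le. Qed.

Lemma ell_mdist u v : mdist u v = `|u - v|.
Proof. by rewrite distrC. Qed.

End ell_infty_coord.

Section row_coord.
Context {R : realType} {n : nat}.
Implicit Types x y : 'rV[R]_n.

Lemma row_coord_le x i : `|x ord0 i| <= `|x|.
Proof. 
rewrite [leRHS]mx_normrE.
by apply: (le_trans _ (le_bigmax _ _ (ord0, i))).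
Qed.

Lemma row_norm_le x (M : R) : 0 <= M -> (forall i, `|x ord0 i| <= M) ->
  `|x| <= M.
Proof.
move=> M0 xM; rewrite [leLHS]mx_normrE; apply: bigmax_le => // -[i j] _ /=.
by rewrite (ord1 i) xM.
Qed.

Lemma row_mdist x y : mdist x y = `|x - y|.
Proof. by rewrite distrC. Qed.

End row_coord.

Section mcshane.
Context {R : realType} {V : normedModType R}.
Implicit Types (A : set V) (x y : V).

(** The extension is the infimum over [a] in [A] of the cones [f a + L * |x - a|]. The last clause
    records that this infimum is approached, which [lipschitz_cutoff] needs. *)
Lemma mcshane_real A (f : V -> R) (L : R) : A !=set0 -> 0 <= L ->
  (forall x y, A x -> A y -> `|f x - f y| <= L * `|x - y|) ->
  exists g : V -> R, [/\ forall x y, `|g x - g y| <= L * `|x - y|,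
    forall x, A x -> g x = f x &
    forall x b, g x < b -> exists2 a, A a & f a + L * `|x - a| < b].
Proof.
move=> [a0 Aa0] L0 fL.
pose S x := [set f a + L * `|x - a| | a in A].
have S0 x : S x !=set0 by exists (f a0 + L * `|x - a0|); exists a0.
have lbS x : lbound (S x) (f a0 - L * `|x - a0|).
  move=> _ [a Aa <-]; have := fL _ _ Aa0 Aa; rewrite ler_norml => /andP[_ h].
  have := ler_wpM2l L0 (ler_distD x a0 a); rewrite mulrDr (distrC a0 x).
  move: h; set p := L * _; set q := L * _; set r := L * _; lra.
have hlb x : has_lbound (S x) by exists (f a0 - L * `|x - a0|).
have half x y : inf (S x) <= inf (S y) + L * `|x - y|.
  rewrite -lerBlDr; apply: lb_le_inf => // _ [a Aa <-].
  rewrite lerBlDr; apply: (@le_trans _ _ (f a + L * `|x - a|)).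
    by apply: ge_inf => //; exists a.
  rewrite -addrA lerD2l -mulrDr ler_wpM2l// [leRHS]addrC.
  exact: ler_distD.
exists (fun x => inf (S x)); split.
- move=> x y; have := half x y; have := half y x; rewrite (distrC y x).
  by rewrite ler_norml; move: (L * _) => p; lra.
- move=> x Ax; apply/eqP; rewrite eq_le; apply/andP; split.
    by apply: ge_inf => //; exists x => //; rewrite subrr normr0 mulr0 addr0.
  apply: lb_le_inf => // _ [a Aa <-].
  by have := fL _ _ Ax Aa; rewrite ler_norml; move: (L * _) => p; lra.
- move=> x b xb; have [_ [a Aa <-] h] := inf_lt (S0 x) xb.
  by exists a.
Qed.

(** Each coordinate is extended with the same [L], which the sup norm preserves. The extended
    sequence is bounded because it stays within [L * |x - a|] of [f a], for a fixed [a] in [A]. *)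
Lemma mcshane_ell A (f : V -> ell_infty R) (L : R) : A !=set0 -> 0 <= L ->
  (forall x y, A x -> A y -> `|f x - f y| <= L * `|x - y|) ->
  exists g : V -> ell_infty R, (forall x y, `|g x - g y| <= L * `|x - y|) /\
    forall x, A x -> g x = f x.
Proof.
move=> A0 L0 fL.
have /choice[g gP] i : exists g : V -> R,
    (forall x y, `|g x - g y| <= L * `|x - y|) /\ forall x, A x -> g x = f x i.
  have [x y Ax Ay|g [g1 g2 _]] := @mcshane_real A (fun x => f x i) L A0 L0.
    by apply: le_trans (fL _ _ Ax Ay); rewrite -ellBE; exact: ell_coord_le.
  by exists g.
have [a Aa] := A0.
have gb x : (fun i => g i x) \in @bounded_seq R.
  apply/asboolP; exists (L * `|x - a| + `|f a|) => i.
  rewrite -(subrK (g i a) (g i x)); apply: le_trans (ler_normD _ _) _.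
  by rewrite lerD// ?(gP i).1// (gP i).2// ell_coord_le.
exists (fun x => EllInfty (gb x)); split.
  by move=> x y; apply: ell_norm_le => i; exact: (gP i).1.
by move=> x Ax; apply/val_inj/funext => i; exact: (gP i).2.
Qed.

Lemma mcshane_row (n : nat) A (f : V -> 'rV[R]_n) (L : R) : A !=set0 -> 0 <= L ->
  (forall x y, A x -> A y -> `|f x - f y| <= L * `|x - y|) ->
  exists g : V -> 'rV[R]_n, (forall x y, `|g x - g y| <= L * `|x - y|) /\
    forall x, A x -> g x = f x.
Proof.
move=> A0 L0 fL.
have /choice[g gP] i : exists g : V -> R,
    (forall x y, `|g x - g y| <= L * `|x - y|) /\
    forall x, A x -> g x = f x ord0 i.
  have [x y Ax Ay|g [g1 g2 _]] := @mcshane_real A (fun x => f x ord0 i) L A0 L0.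
    apply: le_trans (fL _ _ Ax Ay).
    by have := row_coord_le (f x - f y) i; rewrite !mxE.
  by exists g.
exists (fun x => \row_i g i x); split.
  move=> x y; apply: row_norm_le => [|i]; first by rewrite mulr_ge0.
  by rewrite !mxE; exact: (gP i).1.
by move=> x Ax; apply/rowP => i; rewrite mxE; exact: (gP i).2.
Qed.

(** The function is [min (dist (x, A) / s) 1]: the infimum of cones over the zero function is the
    scaled distance to [A]. *)
Lemma lipschitz_cutoff A (s : R) : A !=set0 -> 0 < s ->
  exists psi : V -> R, [/\ forall x, 0 <= psi x <= 1,
    forall x y, `|psi x - psi y| <= s^-1 * `|x - y|,
    forall x, A x -> psi x = 0 &
    forall x, psi x < 1 -> exists2 a, A a & `|x - a| < s].
Proof.
move=> A0 s0; have s'0 : 0 <= s^-1 by rewrite invr_ge0 ltW.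
have [|g [gL gA gb]] := @mcshane_real A (fun=> 0) s^-1 A0 s'0.
  by move=> x y _ _; rewrite subrr normr0 mulr_ge0.
have g0 x : 0 <= g x.
  rewrite leNgt; apply/negP => /gb[a _]; rewrite add0r ltNge => /negP; apply.
  by rewrite mulr_ge0.
exists (fun x => Num.min (g x) 1); split.
- by move=> x; rewrite le_min g0 ler01 ge_min lexx orbT.
- move=> x y; have := gL x y; move: (_ * `|_|) (g x) (g y) => p a b.
  by rewrite !ler_norml /Num.min; case: ifP; case: ifP; lra.
- by move=> x Ax; rewrite gA// min_l.
- move=> x; rewrite gt_min ltxx orbF => /gb[a Aa].
  by rewrite add0r mulrC ltr_pdivrMr// mul1r => xa; exists a.
Qed.

End mcshane.

(** * Hausdorff measure *)

Section hausdorff_facts.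
Context {R : realType} {T : metricType R}.
Implicit Types (A B U : set T) (n : nat).
Local Open Scope ereal_scope.

Lemma diam_ge0 A : 0 <= diam A.
Proof. by apply: ereal_sup_ubound; left. Qed.

Lemma diam_set0 : diam (set0 : set T) = 0.
Proof.
apply/eqP; rewrite eq_le diam_ge0 andbT.
by apply: ge_ereal_sup => _ [->|[x [] //]].
Qed.

Lemma mdist_le_diam A x y : A x -> A y -> (mdist x y)%:E <= diam A.
Proof.
by move=> Ax Ay; apply: ereal_sup_ubound; right; exists x => //; exists y.
Qed.

Lemma diam_le A (d : R) : (0 <= d)%R ->
  (forall x y, A x -> A y -> (mdist x y <= d)%R) -> diam A <= d%:E.
Proof.
move=> d0 Ad; apply: ge_ereal_sup => _ [->|[x Ax [y Ay <-]]].
  by rewrite lee_fin.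
by rewrite lee_fin Ad.
Qed.

Lemma hausdorff_delta_ge0 n d A : 0 <= hausdorff_delta n d A.
Proof.
apply: le_ereal_inf_tmp => _ [F _ <-]; apply: nneseries_ge0 => i _ _.
exact/expe_ge0/diam_ge0.
Qed.

Lemma hausdorff_delta_subset n d A B : A `<=` B ->
  hausdorff_delta n d A <= hausdorff_delta n d B.
Proof.
move=> AB; apply: ereal_inf_le_tmp => _ [F [BF Fd] <-]; exists F => //.
by split => //; exact: subset_trans BF.
Qed.

Lemma hausdorff_delta_le n d d' A : d <= d' ->
  hausdorff_delta n d' A <= hausdorff_delta n d A.
Proof.
move=> dd'; apply: ereal_inf_le_tmp => _ [F [BF Fd] <-]; exists F => //.
by split => // i; exact: le_trans (Fd i) dd'.
Qed.

Lemma hausdorff_measureE n A : hausdorff_measure n A =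
  ereal_sup [set hausdorff_delta n d%:E A | d in [set d : R | (0 < d)%R]].
Proof.
rewrite /hausdorff_measure; apply/cvg_lim; first exact: ereal_hausdorff.
have := @nonincreasing_at_right_cvge R (fun d => hausdorff_delta n d%:E A)
  0%R (BInfty _ false).
rewrite (_ : [set` _] = [set d : R | (0 < d)%R]); last first.
  by apply/seteqP; split => d /=; rewrite in_itv/= andbT.
by apply => // d e _ _ de; apply: hausdorff_delta_le; rewrite lee_fin.
Qed.

Lemma hausdorff_delta_le_measure n (d : R) A : (0 < d)%R ->
  hausdorff_delta n d%:E A <= hausdorff_measure n A.
Proof. by move=> d0; rewrite hausdorff_measureE; apply: ereal_sup_ubound; exists d. Qed.

Lemma hausdorff_measure_le n A M :
  (forall d : R, (0 < d)%R -> hausdorff_delta n d%:E A <= M) ->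
  hausdorff_measure n A <= M.
Proof.
by move=> h; rewrite hausdorff_measureE; apply: ge_ereal_sup => _ [d d0 <-]; exact: h.
Qed.

Lemma hausdorff_measure_ge0 n A : 0 <= hausdorff_measure n A.
Proof.
exact: le_trans (hausdorff_delta_ge0 _ _ _) (hausdorff_delta_le_measure n A ltr01).
Qed.

Lemma hausdorff_measure_subset n A B : A `<=` B ->
  hausdorff_measure n A <= hausdorff_measure n B.
Proof.
move=> AB; apply: hausdorff_measure_le => d d0.
exact: le_trans (hausdorff_delta_subset _ _ AB) (hausdorff_delta_le_measure _ _ d0).
Qed.

(** Each of the infinitely many covering sets contributes 1, even an empty one. This rules out [GTA]
    at points of [G] in dimension 0. *)
Lemma hausdorff_measure_dim0 A : hausdorff_measure 0 A = +oo.
Proof.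
apply/eqP; rewrite -leye_eq.
apply: le_trans (hausdorff_delta_le_measure 0 A ltr01).
apply: le_ereal_inf_tmp => _ [F _ <-].
under eq_eseriesr do rewrite expe0.
rewrite leye_eq; apply/eqP/eqyP => M M0.
pose k := (Num.truncn M).+1.
apply: le_trans (@nneseries_lim_ge _ (fun=> 1) xpredT 0 k _) => //.
rewrite sumEFin lee_fin big_mkord sumr_const card_ord ltW//.
by rewrite /k truncnS_gt.
Qed.

(** A covering set of diameter at most [d] meets at most one of [A] and [B], so a fine cover of [U]
    splits into covers of the two. The positive exponent makes empty covering sets free. *)
Lemma separated_hausdorff_measure n (d : R) A B U : (0 < d)%R ->
  A `<=` U -> B `<=` U ->
  (forall x y, A x -> B y -> (d < mdist x y)%R) ->
  hausdorff_measure n.+1 A + hausdorff_measure n.+1 B <=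
    hausdorff_measure n.+1 U.
Proof.
move=> d0 AU BU AB.
have key (e : R) : (0 < e)%R -> (e <= d)%R -> hausdorff_delta n.+1 e%:E A +
    hausdorff_delta n.+1 e%:E B <= hausdorff_delta n.+1 e%:E U.
  move=> e0 ed; apply: le_ereal_inf_tmp => _ [F [UF Fe] <-].
  pose res E i := if F i `&` E == set0 then set0 else F i.
  have resE E : E `<=` U -> hausdorff_delta n.+1 e%:E E <=
      \sum_(i <oo) diam (res E i) ^+ n.+1.
    move=> EU; apply: ereal_inf_lbound; exists (res E) => //; split.
      move=> x Ex; have [i _ Fx] := UF _ (EU _ Ex); exists i => //.
      rewrite /res; case: ifPn => // /eqP; rewrite -subset0 => /(_ x).
      by case; split.
    by move=> i; rewrite /res; case: ifP => // _; rewrite diam_set0 lee_fin ltW.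
  apply: le_trans (leeD (resE _ AU) (resE _ BU)) _.
  rewrite -nneseriesD; try by move=> *; exact/expe_ge0/diam_ge0.
  apply: lee_nneseries => [i _ _|i _]; first by
    apply: adde_ge0; exact/expe_ge0/diam_ge0.
  have z : diam (set0 : set T) ^+ n.+1 = 0 by rewrite diam_set0 expeS mul0e.
  rewrite /res; case: ifPn => [_|/set0P[x [Fx Ax]]]; case: ifPn.
  - by rewrite z adde0 => _; exact/expe_ge0/diam_ge0.
  - by rewrite z add0e.
  - by rewrite z adde0.
  - move=> /set0P[y [Fy By]]; exfalso.
    have := le_trans (mdist_le_diam Fx Fy) (Fe i).
    by rewrite lee_fin leNgt (le_lt_trans ed)// AB.
case: (hausdorff_measure n.+1 U) (fun e e0 ed => le_trans (key e e0 ed)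
    (hausdorff_delta_le_measure n.+1 U e0)) => [M h|_|h]; last 2 first.
- by rewrite leey.
- have := h d d0 (lexx d); rewrite leNgt; case/negP.
  by rewrite (lt_le_trans (ltNyr 0%R))// adde_ge0// hausdorff_delta_ge0.
(* With two independent scales, the suprema over them can be taken one after the other. *)
have {}h e1 e2 : (0 < e1)%R -> (0 < e2)%R -> hausdorff_delta n.+1 e1%:E A +
    hausdorff_delta n.+1 e2%:E B <= M%:E.
  move=> e10 e20; pose e := Num.min d (Num.min e1 e2).
  have e0 : (0 < e)%R by rewrite !lt_min d0 e10 e20.
  apply: le_trans (h e e0 _); last by rewrite ge_min lexx.
  by apply: leeD; apply: hausdorff_delta_le; rewrite lee_fin !ge_min lexx ?orbT.
have finA e : (0 < e)%R -> hausdorff_delta n.+1 e%:E A \is a fin_num.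
  move=> e0; rewrite ge0_fin_numE ?hausdorff_delta_ge0//.
  apply: le_lt_trans (ltry M); apply: le_trans (h e e e0 e0).
  by rewrite leeDl// hausdorff_delta_ge0.
have finB : hausdorff_measure n.+1 B \is a fin_num.
  rewrite ge0_fin_numE ?hausdorff_measure_ge0//.
  apply: le_lt_trans (ltry M); apply: hausdorff_measure_le => e e0.
  by apply: le_trans (h e e e0 e0); rewrite leeDr// hausdorff_delta_ge0.
rewrite -leeBrDr//; apply: hausdorff_measure_le => e e0.
rewrite leeBrDr// addeC -leeBrDr ?finA//.
apply: hausdorff_measure_le => e' e'0.
by rewrite leeBrDr ?finA// addeC h.
Qed.

Lemma separated_hausdorff_measure_seq (I : eqType) n (E : I -> set T) U
    (s : seq I) : uniq s ->
  (forall i, i \in s -> E i `<=` U) ->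
  (forall i j, i \in s -> j \in s -> i != j -> exists2 d : R, (0 < d)%R &
    forall x y, E i x -> E j y -> (d < mdist x y)%R) ->
  \sum_(i <- s) hausdorff_measure n.+1 (E i) <= hausdorff_measure n.+1 U.
Proof.
elim: s U => [|i s IHs] U; first by rewrite big_nil hausdorff_measure_ge0.
rewrite big_cons => /andP[nis us] sU sep.
pose V := [set x | exists2 j, j \in s & E j x].
have [d d0 hd] : exists2 d : R, (0 < d)%R &
    forall x y, E i x -> V y -> (d < mdist x y)%R.
  have {}sep j : j \in s -> exists2 d : R, (0 < d)%R &
      forall x y, E i x -> E j y -> (d < mdist x y)%R.
    move=> js; apply: sep; rewrite ?mem_head ?in_cons ?js ?orbT//.
    by apply: contraNneq nis => ->.
  rewrite {}/V; elim: s {nis us sU IHs} sep => [|j s IHs] sep.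
    by exists 1%R => // x y _ [].
  have [k ks|d1 d10 h1] := IHs; first by apply: sep; rewrite in_cons ks orbT.
  have [d2 d20 h2] := sep j (mem_head _ _).
  exists (Num.min d1 d2); first by rewrite lt_min d10.
  move=> x y Ex [k]; rewrite in_cons => /orP[/eqP ->|ks] Ey.
    by rewrite gt_min (h2 x y) ?orbT.
  by rewrite gt_min (h1 x y)//; exists k.
apply: le_trans (@separated_hausdorff_measure n d (E i) V U d0 _ _ hd).
- apply: leeD => //; apply: IHs => // [j js x Ex|j k js ks]; first by exists j.
  by apply: sep; rewrite in_cons ?js ?ks orbT.
- by apply: sU; rewrite mem_head.
- by move=> x [j js]; apply: sU; rewrite in_cons js orbT.
Qed.

End hausdorff_facts.

(** * Content of a set covered by dense balls *)

(** Going up in [k], a maximal disjoint family is chosen among the balls of index [k] that miss all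
    those chosen before; [Dlt k] collects the choices of index below [k]. Every ball then meets a
    chosen one of no larger index, hence of no smaller radius. *)
Lemma vitali_nonincreasing_radii (R : realType) (T : metricType R)
    (rad : nat -> R) (V : set (nat * T)) :
  (forall k, 0 <= rad k) -> {homo rad : j k / (j <= k)%N >-> k <= j} ->
  exists D : set (nat * T), [/\ D `<=` V,
    trivIset D (fun i => cball i.2 (rad i.1)) &
    forall i, V i -> exists2 j, D j & rad i.1 <= rad j.1 /\
      cball i.2 (rad i.1) `&` cball j.2 (rad j.1) !=set0].
Proof.
move=> rad0 radle; pose B (i : nat * T) := cball i.2 (rad i.1).
have Bc i : B i i.2 by rewrite /B /cball/= mdistxx.
pose W k (E : set (nat * T)) :=
  [set i | [/\ V i, i.1 = k & forall j, E j -> ~ (B i `&` B j !=set0)]].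
pose pick k E := sval (ex_maximal_disjoint_subcollection B (W k E)).
have pickP k E : maximal_disjoint_subcollection B (pick k E) (W k E).
  by rewrite /pick; case: ex_maximal_disjoint_subcollection.
pose fix Dlt k := if k is k'.+1 then Dlt k' `|` pick k' (Dlt k') else set0.
have DltS k j : (k <= j)%N -> Dlt k `<=` Dlt j.
  move=> kj; rewrite -(subnKC kj); elim: (j - k)%N => [|l IH]; first by rewrite addn0.
  by rewrite addnS => x /IH xD; left.
have DltV k i : Dlt k i -> V i /\ (i.1 < k)%N.
  elim: k => [//|k IH] [/IH[Vi /ltnW ik]|]; first by split.
  by have [sub _ _] := pickP k (Dlt k) => /sub[Vi -> _].
exists (\bigcup_k Dlt k); split.
- by move=> i [k _] /DltV[].
- have tDlt k : trivIset (Dlt k) B.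
    elim: k => [|k IH] i j //=.
    have [sub tr _] := pickP k (Dlt k).
    move=> [Di|Di] [Dj|Dj] ij; [exact: IH| | |exact: tr].
    + by have [_ _ /(_ _ Di)] := sub _ Dj; rewrite setIC => /(_ ij).
    + by have [_ _ /(_ _ Dj)] := sub _ Di => /(_ ij).
  move=> i j [k _ Di] [l _ Dj]; apply: (tDlt (maxn k l)).
    by apply: (DltS k) => //; rewrite leq_maxl.
  by apply: (DltS l) => //; rewrite leq_maxr.
- move=> i Vi; pose E := Dlt i.1.
  have [[j Ej ij]|nE] := pselect (exists2 j, E j & (B i `&` B j !=set0)).
    exists j; first by exists i.1.
    by split => //; apply: radle; rewrite ltnW// (DltV _ _ Ej).2.
  have Wi : W i.1 E i by split => // j Ej ij; apply: nE; exists j.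
  have [sub tr mx] := pickP i.1 E.
  have inD j : pick i.1 E j -> (\bigcup_k Dlt k) j by move=> Ej; exists i.1.+1 => //; right.
  have [pi|npi] := pselect (pick i.1 E i).
    by exists i; [exact: inD|split=> //; exists i.2; split; exact: Bc].
  have [[j pj ij]|np] := pselect (exists2 j, pick i.1 E j & (B i `&` B j !=set0)).
    exists j; [exact: inD|split=> //; have [_ -> _] := sub _ pj => //].
  exfalso; apply: (mx (pick i.1 E `|` [set i])).
  + split; first by move=> x; left.
    by move=> /(_ i); apply/not_implyP; split => //; right.
  + by move=> j [/sub//|->].
  + move=> j k [pj|->] [pk|->] // jk; first exact: tr.
      by exfalso; apply: np; exists j => //; rewrite setIC.
    by exfalso; apply: np; exists k.
Qed.

Section content_of_dense_balls.
Context {R : realType} {T : metricType R}.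
Variables (n : nat) (rad : nat -> R) (V : set (nat * T)) (E U : set T).
Variables (eta lam : R).
Hypothesis eta_gt0 : 0 < eta.
Hypothesis lam_ge3 : 3 <= lam.
Hypothesis rad_gt0 : forall k, 0 < rad k.
Hypothesis rad_le : {homo rad : j k / (j <= k)%N >-> k <= j}.
Hypothesis dense : forall i, V i -> ((eta * rad i.1 ^+ n.+1)%:E <=
  hausdorff_measure n.+1 (U `&` cball i.2 (rad i.1)))%E.

(** Centres are further apart than [lam] times either radius, since otherwise a dilated ball would
    contain the centre of another. As [lam >= 3], the undilated balls lie at positive distance and
    their measures add. *)
Lemma sum_disjoint_dense_balls (D : set (nat * T)) (s : seq (nat * T)) :
  D `<=` V -> trivIset D (fun i => cball i.2 (lam * rad i.1)%R) ->
  uniq s -> (forall i, i \in s -> D i) ->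
  (\sum_(i <- s) (eta * rad i.1 ^+ n.+1)%:E <= hausdorff_measure n.+1 U)%E.
Proof.
move=> DV tD us sD.
apply: (@le_trans _ _ (\sum_(i <- s) hausdorff_measure n.+1
    (U `&` cball i.2 (rad i.1)%R))%E).
  by rewrite big_seq [leRHS]big_seq; apply: lee_sum => i /sD/DV/dense.
apply: separated_hausdorff_measure_seq => // i j /sD Di /sD Dj ij.
have lam0 : 0 <= lam by rewrite (le_trans _ lam_ge3).
have c (k : nat * T) : cball k.2 (lam * rad k.1) k.2.
  by rewrite /cball/= mdistxx mulr_ge0// ltW.
have far (k l : nat * T) : D k -> D l -> k != l -> lam * rad k.1 < mdist k.2 l.2.
  move=> Dk Dl /eqP kl; rewrite ltNge; apply/negP => h.
  by apply: kl; apply: tD => //; exists l.2; split.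
have := far _ _ Di Dj ij; have := far _ _ Dj Di; rewrite eq_sym => /(_ ij).
rewrite (metric_sym j.2) => f1 f2.
exists (Num.min (rad i.1) (rad j.1)); first by rewrite lt_min !rad_gt0.
move=> x y [_ xi] [_ yj]; move: xi yj; rewrite /cball/= => xi yj.
have := metric_triangle i.2 x j.2; have := metric_triangle x y j.2.
rewrite (metric_sym y) gt_min => t1 t2.
have := ler_wpM2r (ltW (rad_gt0 i.1)) lam_ge3.
have := ler_wpM2r (ltW (rad_gt0 j.1)) lam_ge3.
have := rad_gt0 i.1; have := rad_gt0 j.1.
move: f1 f2 xi yj t1 t2; set p := lam * _; set q := lam * _.
by case: (leP (rad i.1) (rad j.1)) => *; apply/orP; [left|right]; lra.
Qed.

(** [T] may be nonseparable, so countability comes from mass: balls of one index have a common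
    positive lower bound for their mass, and a finite measure leaves room for finitely many of
    them. *)
Lemma countable_disjoint_dense_balls (D : set (nat * T)) :
  D `<=` V -> trivIset D (fun i => cball i.2 (lam * rad i.1)%R) ->
  (hausdorff_measure n.+1 U < +oo)%E -> countable D.
Proof.
move=> DV tD Ufin.
have -> : D = \bigcup_k [set i | D i /\ i.1 = k].
  by apply/seteqP; split => [i Di|i [k _ []]//]; exists i.1.
apply: bigcup_countable => // k _.
apply: finite_set_countable; apply: contrapT => inf.
have Ufn : hausdorff_measure n.+1 U \is a fin_num.
  by rewrite ge0_fin_numE ?hausdorff_measure_ge0.
pose a := eta * rad k ^+ n.+1; have a0 : 0 < a by rewrite mulr_gt0// exprn_gt0.
pose N := (Num.truncn (fine (hausdorff_measure n.+1 U) / a)).+1.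
have [B BD NB] := infinite_set_fset N inf.
have := @sum_disjoint_dense_balls D (finmap.enum_fset B) DV tD (finmap.fset_uniq B).
rewrite leNgt => /(_ (fun i iB => (BD i iB).1))/negP; apply.
rewrite big_seq (eq_bigr (fun=> a%:E)); last by move=> i iB; rewrite (BD i iB).2.
rewrite -big_seq sumEFin big_const_seq count_predT iter_addr_0.
rewrite -(fineK Ufn) lte_fin -mulr_natl -ltr_pdivrMr//.
by rewrite (lt_le_trans (truncnS_gt _))// ler_nat.
Qed.

(** A Vitali selection is made among the balls of radius [lam * rad]. The selected balls, tripled,
    cover [E] and have diameter at most [6 * lam * rad], while density bounds the sum of
    [eta * rad ^+ n.+1] by the measure of [U]. *)
Lemma hausdorff_content_dense_balls :
  (forall y, E y -> exists2 i, V i & mdist i.2 y <= lam * rad i.1) ->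
  (hausdorff_content n.+1 E <=
   ((6 * lam) ^+ n.+1 / eta)%:E * hausdorff_measure n.+1 U)%E.
Proof.
move=> EV.
have lam0 : 0 < lam by rewrite (lt_le_trans _ lam_ge3).
have C0 : 0 < (6 * lam) ^+ n.+1 / eta by rewrite divr_gt0// exprn_gt0// mulr_gt0.
have [->|Ufin] := eqVneq (hausdorff_measure n.+1 U) +oo%E.
  by rewrite mulry gtr0_sg// mul1e leey.
rewrite -ltey in Ufin.
have lr0 k : 0 <= lam * rad k by rewrite mulr_ge0// ltW.
have [|D [DV tD cD]] := @vitali_nonincreasing_radii R T (fun k => lam * rad k) V lr0.
  by move=> j k jk; rewrite ler_pM2l//; exact: rad_le.
have /countable_injP[f finj] := countable_disjoint_dense_balls DV tD Ufin.
(* [g] inverts the injection [f] of [D] into [nat]; indices outside its range receive the empty set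
   in the cover [F]. *)
pose g i : option (nat * T) :=
  if pselect (exists2 j, D j & f j = i) is left h then Some (sval (cid2 h)) else None.
have gD i j : g i = Some j -> D j /\ f j = i.
  by rewrite /g; case: pselect => // h [<-]; case: cid2.
have gf j : D j -> g (f j) = Some j.
  move=> Dj; rewrite /g; case: pselect => [h|]; last by case; exists j.
  by case: cid2 => k Dk /= fk; congr Some; apply: finj; rewrite ?inE.
pose F i := if g i is Some j then cball j.2 (3 * (lam * rad j.1)) else set0.
apply: (@le_trans _ _ (\sum_(i <oo) diam (F i) ^+ n.+1)%E).
  apply: ereal_inf_lbound; exists F => //; split; last by move=> i; exact: leey.
  move=> y /EV[i Vi yi]; have [j Dj [ij [z [zi zj]]]] := cD i Vi.
  exists (f j) => //; rewrite /F gf//=.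
  have := metric_triangle j.2 z y; have := metric_triangle z i.2 y.
  move: zi zj; rewrite /cball/= (metric_sym i.2 z); lra.
apply: lime_le; first by apply: is_cvg_nneseries => i _ _; exact/expe_ge0/diam_ge0.
apply: nearW => N.
have us : uniq (pmap g (iota 0 N)).
  apply: (@pmap_uniq _ _ g f); last exact: iota_uniq.
  by move=> i; case: (g i) (gD i) => //= j /(_ j erefl)[].
have := sum_disjoint_dense_balls DV tD us.
have sD : forall i, i \in pmap g (iota 0 N) -> D i.
  move=> j; rewrite mem_pmap => /mapP[i _ gij].
  by have [] := gD i j (esym gij).
move=> /(_ sD) le; apply: le_trans (lee_wpmul2l _ le); last by rewrite lee_fin ltW.
rewrite big_pmap -/(index_iota 0 N) /index_iota subn0.
rewrite ge0_sume_distrr; last first.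
  move=> i _; case: (g i) => //= j; rewrite lee_fin mulr_ge0 ?(ltW eta_gt0)//.
  by rewrite exprn_ge0// ltW.
apply: lee_sum => i _; rewrite /F; case: (g i) => [j|]; last first.
  by rewrite diam_set0 expeS mul0e mule0.
rewrite [leRHS](_ : _ = ((6 * lam * rad j.1) ^+ n.+1)%:E); last first.
  by rewrite /= -EFinM; congr (_%:E); rewrite [RHS]exprMn mulrA divfK ?gt_eqF.
have : (diam (cball j.2 (3 * (lam * rad j.1))%R) <= (6 * lam * rad j.1)%:E)%E.
  have := lr0 j.1 => l0.
  apply: diam_le => [|x y]; first lra.
  have := metric_triangle x j.2 y; rewrite /cball/= (metric_sym x j.2); lra.
have := diam_ge0 (cball j.2 (3 * (lam * rad j.1))%R).
case: (diam _) => // d; rewrite !lee_fin => d0 dle.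
by rewrite -EFin_expe lee_fin lerXn2r// nnegrE// (le_trans d0).
Qed.

End content_of_dense_balls.

(** * Charts given by good tangential approximation *)

Lemma edist_inf_lt_mdist (R : realType) (Z : metricType R) (B : set Z) (a : Z)
    (d : R) : (edist_inf B a < d%:E)%E -> exists2 b, B b & mdist a b < d.
Proof.
move=> /ereal_inf_lt[_ [b Bb <-]] /edist_lt_ball/=.
by rewrite ballEmdist => ab; exists b.
Qed.

(** As [d < 1/2], the default value [1/2] of [pH] is excluded. *)
Lemma pH_lt (R : realType) (Z : metricType R) (z : Z) (A B : set Z) (d : R) :
  d < 2^-1 -> pH z A B < d -> exists2 e, pH_admissible z A B e & e < d.
Proof.
rewrite /pH => d2; case: ifPn => [_ /(lt_trans d2)|/set0P ne].
  by rewrite ltxx.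
by move=> /(inf_lt ne)[e Ae ed]; exists e.
Qed.

Section chart_net.
Context {R : realType} {T : metricType R} {n : nat}.
Variables (eta K delta R0 : R) (X C G : set T).
Hypothesis XCG : GTA n eta K delta R0 X C G.
Hypothesis Kdelta : K * (2 * K) <= delta^-1.

(** [c] follows a bi-Lipschitz parametrisation of [Y] and picks nearby points of [C']; two
    comparisons, each costing [delta], give the additive error [2 * delta]. For the last clause,
    lower regularity brings [u] near [C'], and the comparison with [Y] then supplies [b]. *)
Lemma GTA_chart_net (g : T) (rho : R) : G g -> 0 < rho <= R0 ->
  exists c : 'rV[R]_n -> T, [/\ c 0 = g,
    forall a, K * `|a| <= delta^-1 -> C (c a),
    forall a b, K * `|a| <= delta^-1 -> K * `|b| <= delta^-1 ->
      mdist (c a) (c b) <= rho * (K * `|a - b| + 2 * delta) /\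
      `|a - b| <= K * (mdist (c a) (c b) / rho + 2 * delta) &
    forall u, C u -> mdist g u <= rho / 2 ->
      exists2 b : 'rV[R]_n, `|b| <= 2 * K & mdist u (c b) <= 3 * delta * rho].
Proof.
move=> Gg /andP[rho0 rhoR0].
have [_ _ _ _ _ K1 eta0 R00 /andP[delta0 delta2] lower tangent] := XCG.
have K0 : 0 < K by rewrite (lt_le_trans ltr01).
have [C' [C'g [_ C'C small]]] := tangent g (PosNum rho0) Gg rhoR0.
move=> /ereal_inf_lt[_ [Y [y [[_ [f0 [f0T [f0L [g0 [g0f g0L]]]]]] ->]]]].
move=> /ereal_inf_lt[_ [Z [z [fX [gY [fXi gYi fXz gYz ->]]]]]].
rewrite lte_fin lt_min => /andP[pHd _].
have [e [/andP[e0 e2] XY YX] ed] := pH_lt delta2 pHd.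
have dVe : delta^-1 <= e^-1 by rewrite lef_pV2 ?posrE// ltW.
have [a0 _ fa0] : range f0 y by rewrite f0T.
(* [biLip] does not ask that 0 go to the base point; a translation arranges this. *)
pose f a := f0 (a0 + a).
have f_0 : f 0 = y by rewrite /f addr0.
have fL a b : mdist (f a) (f b) <= K * `|a - b|.
  have := f0L (a0 + a) (a0 + b) I I; rewrite row_mdist.
  by rewrite opprD addrACA subrr add0r.
have fl a b : `|a - b| <= K * mdist (f a) (f b).
  have := g0L (f a) (f b); rewrite /f !g0f// row_mdist opprD addrACA subrr add0r.
  by apply; eexists; split.
have fz a : mdist z (gY (f a)) <= K * `|a|.
  by rewrite -gYz gYi -f_0 (le_trans (fL _ _))// sub0r normrN.
(* The choice at 0 is prescribed, so that [c 0 = g] holds exactly and not only up to an error. *)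
have /choice[w wP] a : exists w : scaled_subspace C' (PosNum rho0),
    (a = 0 -> w = scaled_point (PosNum rho0) C'g) /\
    (K * `|a| <= delta^-1 -> mdist (gY (f a)) (fX w) < delta).
  have [->|a_neq0] := eqVneq a 0.
    exists (scaled_point (PosNum rho0) C'g); split => // _.
    by rewrite f_0 gYz fXz mdistxx.
  have [aK|aK] := leP (K * `|a|) delta^-1; last first.
    by exists (scaled_point (PosNum rho0) C'g); split => // a0'; rewrite a0' eqxx in a_neq0.
  have [|_ [w _ <-] wd] := @edist_inf_lt_mdist _ _ (range fX) (gY (f a)) delta.
    apply: le_lt_trans (YX _ _ _) _; last by rewrite lte_fin.
      by exists (f a).
    by rewrite /cball/= (le_trans (fz a))// (le_trans aK).
  by exists w; split => // a0'; rewrite a0' eqxx in a_neq0.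
have scaledE (v w' : scaled_subspace C' (PosNum rho0)) :
    mdist (fX v) (fX w') = mdist (sval v) (sval w') / rho by rewrite fXi.
exists (fun a => sval (w a)); split.
- by rewrite (wP 0).1.
- by move=> a _; apply: C'C; exact: set_mem (svalP (w a)).
- move=> a b aK bK.
  have := fL a b; have := fl a b; rewrite -gYi.
  have := (wP a).2 aK; have := (wP b).2 bK.
  have := metric_triangle (gY (f a)) (fX (w a)) (gY (f b)).
  have := metric_triangle (fX (w a)) (fX (w b)) (gY (f b)).
  have := metric_triangle (fX (w a)) (gY (f a)) (fX (w b)).
  have := metric_triangle (gY (f a)) (gY (f b)) (fX (w b)).
  rewrite (metric_sym (fX (w a)) (gY (f a))) (metric_sym (fX (w b)) (gY (f b))).
  rewrite (scaledE (w a)) => t1 t2 t3 t4 wb wa lo up; split.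
    rewrite mulrC -ler_pdivrMr//; lra.
  by apply: le_trans lo _; rewrite ler_pM2l//; lra.
- move=> u Cu gu.
  have [u' C'u' uu'] : exists2 u', C' u' & mdist u u' <= delta * rho.
    (* If [C'] missed the ball of radius [delta * rho] around [u], the mass
       [eta * (delta * rho) ^+ n] of this ball would contradict [small]. *)
    apply: contrapT => none; move: small; apply/negP; rewrite -leNgt.
    have ur : 0 < delta * rho <= R0.
      by rewrite mulr_gt0//= (le_trans _ rhoR0)// ler_piMl// ?ltW//; lra.
    apply: le_trans (lower u _ Cu ur) _; apply: hausdorff_measure_subset.
    move=> v [uv Xv]; split; last by move=> C'v; apply: none; exists v.
    split => //; have := metric_triangle g u v; move: uv; rewrite /cball/=.
    have : delta * rho <= 2^-1 * rho by rewrite ler_pM2r// ltW.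
    lra.
  pose w' := scaled_point (PosNum rho0) C'u'.
  have gw' : mdist z (fX w') <= 2^-1 + delta.
    rewrite -fXz scaledE ler_pdivrMr// mulrDl.
    have := metric_triangle g u u'; rewrite /=; lra.
  have [|_ [y' _ <-] y'w'] := @edist_inf_lt_mdist _ _ (range gY) (fX w') delta.
    apply: le_lt_trans (XY _ _ _) _; last by rewrite lte_fin.
      by exists w'.
    rewrite /cball/= (le_trans gw')// (@le_trans _ _ 1)//; first lra.
    by rewrite -invr1 lef_pV2 ?posrE//; lra.
  have [b fb] : exists b, f b = y'.
    have [b _ fb] : range f0 y' by rewrite f0T.
    by exists (b - a0); rewrite /f addrC subrK.
  have b2 : `|b| <= K * (2^-1 + 2 * delta).
    have := fl b 0; rewrite subr0 => /le_trans; apply; rewrite ler_pM2l//.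
    rewrite -gYi fb f_0 gYz metric_sym.
    have := metric_triangle z (fX w') (gY y'); lra.
  have b2K : `|b| <= 2 * K.
    by apply: le_trans b2 _; rewrite mulrC ler_pM2r//; lra.
  have bK : K * `|b| <= delta^-1.
    by apply: le_trans Kdelta; rewrite ler_pM2l.
  exists b => //; have := (wP b).2 bK; rewrite fb metric_sym => wb.
  have : mdist (fX w') (fX (w b)) <= 2 * delta.
    rewrite (le_trans (metric_triangle _ (gY y') _))// (metric_sym _ (fX (w b))).
    lra.
  rewrite scaledE ler_pdivrMr//=.
  have := metric_triangle u u' (sval (w b)); lra.
Qed.

End chart_net.

(** * Rounding to a lattice *)

Section rounding.
Context {R : realType}.

Definition lattice_round (o tau x : R) : R :=
  o + tau * (Num.floor ((x - o) / tau + 2^-1))%:~R.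

Lemma lattice_round_dist (o tau x : R) : 0 < tau ->
  `|x - lattice_round o tau x| <= tau / 2.
Proof.
move=> t0; rewrite /lattice_round; set k := Num.floor _.
have /andP[k1 k2] := floor_itv ((x - o) / tau + 2^-1).
have hx : x - o = tau * ((x - o) / tau) by rewrite mulrC divfK ?gt_eqF.
rewrite -/k intrD in k1 k2; move: hx k1 k2; set w := (x - o) / tau => hx k1 k2.
have -> : x - (o + tau * k%:~R) = tau * (w - k%:~R) by rewrite mulrBr -hx; ring.
by rewrite normrM gtr0_norm// ler_pM2l// ler_norml; lra.
Qed.

Lemma lattice_round_eq (o tau x : R) (k : int) : 0 < tau ->
  `|x - (o + tau * k%:~R)| < tau / 2 -> lattice_round o tau x = o + tau * k%:~R.
Proof.
move=> t0; have hx : x - o = tau * ((x - o) / tau) by rewrite mulrC divfK ?gt_eqF.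
have -> : x - (o + tau * k%:~R) = tau * ((x - o) / tau - k%:~R).
  by rewrite mulrBr -hx; ring.
rewrite normrM gtr0_norm// ltr_pM2l// ltr_norml => h.
rewrite /lattice_round (@floor_def _ _ k)// intrD; lra.
Qed.

Lemma lattice_round_sep (o tau x y : R) : 0 < tau ->
  lattice_round o tau x != lattice_round o tau y ->
  tau <= `|lattice_round o tau x - lattice_round o tau y|.
Proof.
move=> t0; rewrite /lattice_round.
move: (Num.floor ((x - o) / tau + 2^-1)) (Num.floor ((y - o) / tau + 2^-1)) => k l kl.
rewrite opprD addrACA subrr add0r -mulrBr normrM gtr0_norm// ler_peMr// ?(ltW t0)//.
rewrite -intrB -intr_norm ler1z -gtz0_ge1 normr_gt0 subr_eq0.
by apply: contraNneq kl => ->.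
Qed.

(** The lattices [2 s Z] and [s + 2 s Z] together form [s Z], and every real is within [s / 2] of
    that. *)
Lemma lattice_round_near (s x : R) : 0 < s ->
  `|x - lattice_round 0 (2 * s) x| <= s / 2 \/
  `|x - lattice_round s (2 * s) x| <= s / 2.
Proof.
move=> s0; have s20 : 0 < 2 * s by rewrite mulr_gt0.
have := lattice_round_dist 0 x s20; rewrite {1 2}/lattice_round add0r.
set k := Num.floor _ => h.
have [|h'] := leP `|x - 2 * s * k%:~R| (s / 2); first by left.
right; have e (z : int) : `|x - (s + 2 * s * z%:~R)| <= s / 2 ->
    `|x - lattice_round s (2 * s) x| <= s / 2.
  by move=> xz; rewrite (lattice_round_eq s20 _ (k := z))//; lra.
have [kx|xk] := leP (2 * s * k%:~R) x.
  apply: (e k); move: h h'; rewrite ger0_norm ?subr_ge0// ler_norml; lra.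
apply: (e (k - 1)); move: h h'; rewrite intrB mulrBr ltr0_norm ?subr_lt0// ler_norml; lra.
Qed.

Context {n : nat}.

Definition row_round (o : 'rV[R]_n) (tau : R) (x : 'rV[R]_n) : 'rV[R]_n :=
  \row_i lattice_round (o ord0 i) tau (x ord0 i).

Lemma row_round_dist (o : 'rV[R]_n) tau x : 0 < tau ->
  `|x - row_round o tau x| <= tau / 2.
Proof.
move=> t0; apply: row_norm_le => [|i]; first by rewrite divr_ge0// ltW.
by rewrite !mxE lattice_round_dist.
Qed.

(** The open ball of radius [tau / 2] around a lattice point lies in one rounding cell. With
    [tau = 2 s] this separates the balls of one colour. *)
Lemma row_round_eq (o : 'rV[R]_n) tau x y : 0 < tau ->
  `|x - row_round o tau y| < tau / 2 -> row_round o tau x = row_round o tau y.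
Proof.
move=> t0 xy; apply/rowP => i; rewrite !mxE /=; apply: lattice_round_eq => //.
by apply: le_lt_trans xy; have := row_coord_le (x - row_round o tau y) i; rewrite !mxE.
Qed.

Lemma row_round_sep (o : 'rV[R]_n) tau x y : 0 < tau ->
  row_round o tau x != row_round o tau y ->
  tau <= `|row_round o tau x - row_round o tau y|.
Proof.
move=> t0 xy; have [i xyi] : exists i, row_round o tau x ord0 i != row_round o tau y ord0 i.
  apply/existsP; rewrite -negb_forall; apply: contra xy => /forallP h.
  by apply/eqP/rowP => i; apply/eqP.
have := row_coord_le (row_round o tau x - row_round o tau y) i.
apply: le_trans; move: xyi; rewrite !mxE; exact: lattice_round_sep.
Qed.

Lemma row_round_near (s : R) (x : 'rV[R]_n) : 0 < s ->
  exists e : {ffun 'I_n -> bool},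
    `|x - row_round (\row_i (if e i then s else 0)) (2 * s) x| <= s / 2.
Proof.
move=> s0.
have /choice[e eP] i : exists b : bool,
    `|x ord0 i - lattice_round (if b then s else 0) (2 * s) (x ord0 i)| <= s / 2.
  by case: (lattice_round_near (x ord0 i) s0); [exists false|exists true].
exists [ffun i => e i]; apply: row_norm_le => [|i]; first by rewrite divr_ge0// ltW.
by rewrite !mxE ffunE.
Qed.

End rounding.

(** * Approximate Lipschitz retractions onto C *)

Section retraction.
Context {R : realType} {n : nat}.
Variables (eta K delta R0 : R) (X C G : set (ell_infty R)).
Hypothesis XCG : GTA n eta K delta R0 X C G.
Hypothesis Kdelta : 4 * K * K <= delta^-1.

(* The retraction is [E \o F], where [E] and [F] extend a chart and its inverse
   on a lattice of mesh [4 K delta]: at this mesh the error [2 delta] of the chart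
   costs at most half of the lower Lipschitz bound, so [F] is [2 K]-Lipschitz. *)
Definition retract_lip : R := 2 * K * (K + 1).
Definition retract_err : R := (retract_lip + 1) * (4 * K * K + 5).

(** [E \o F] fixes [c a] for [a] in [A]. If [u] is within [rho] of [g], then [F u] has norm at most
    [2 * K], hence lies within [tau] of [A], and [E] sends it close to some [c a]. If [u] is in [C]
    and within [rho / 2] of [g], the net puts [u] itself close to a fixed point [c a]. *)
Lemma GTA_retraction (g : ell_infty R) (rho : R) : G g -> 0 < rho <= R0 ->
  exists P : ell_infty R -> ell_infty R,
  [/\ forall u v, `|P u - P v| <= retract_lip * `|u - v|,
    forall u, `|u - g| <= rho ->
      exists2 c, C c & `|P u - c| <= retract_err * delta * rho &
    forall u, C u -> `|u - g| <= rho / 2 ->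
      `|P u - u| <= retract_err * delta * rho].
Proof.
move=> Gg rhoR; have /andP[rho0 _] := rhoR.
have K1 := GTA_K XCG; have /andP[delta0 _] := GTA_delta XCG.
have K0 : 0 < K by rewrite (lt_le_trans ltr01).
have KK1 : 1 <= K * K by rewrite mulr_ege1.
have delta4 : 4 * delta <= 1.
  rewrite -ler_pdivlMr// mul1r (le_trans _ Kdelta)//; lra.
have Kd2 : K * (2 * K) <= delta^-1 by apply: le_trans Kdelta; lra.
have [c [c0 cC cbi cnet]] := GTA_chart_net XCG Kd2 Gg rhoR.
pose tau := 4 * K * delta.
have tau0 : 0 < tau by rewrite !mulr_gt0.
have tauK : tau <= K by rewrite /tau mulrAC ler_piMl// ltW.
have tau2 : 2 * delta <= tau.
  by rewrite /tau ler_pM2r//; lra.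
pose A := [set a : 'rV[R]_n | K * `|a| <= delta^-1 /\
  exists p, a = row_round 0 tau p].
have Asep a b : A a -> A b -> a != b -> tau <= `|a - b|.
  by move=> [_ [p ->]] [_ [q ->]]; exact: row_round_sep.
have A0 : A 0.
  split; first by rewrite normr0 mulr0 invr_ge0 ltW.
  exists 0; apply/rowP => i; rewrite !mxE (lattice_round_eq tau0 _ (k := 0)).
    by rewrite mulr0 addr0.
  by rewrite mulr0 addr0 subrr normr0 divr_gt0.
have Anet p : `|p| <= 2 * K -> exists2 a, A a & `|p - a| <= tau.
  move=> p2; have h : `|p - row_round 0 tau p| <= tau.
    by apply: le_trans (row_round_dist _ _ tau0) _; rewrite ler_pdivrMr// ler_peMr// ?ltW//; lra.
  exists (row_round 0 tau p) => //; split; last by exists p.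
  apply: le_trans Kdelta; rewrite mulrC ler_pM2r//.
  have := ler_distD p (row_round 0 tau p) 0; rewrite !subr0 distrC; lra.
have L10 : 0 <= rho * (K + 1) by rewrite mulr_ge0 ?ltW//; lra.
(* Distinct points of [A] are at least [tau >= 2 * delta] apart, so the additive error of the chart
   raises [K] to at most [K + 1]. *)
have [a b Aa Ab|E [EL EA]] := @mcshane_ell R _ A c (rho * (K + 1)) (ex_intro _ 0 A0) L10.
  have [->|ab] := eqVneq a b; first by rewrite !subrr !normr0 mulr0.
  have [+ _] := cbi _ _ Aa.1 Ab.1; rewrite ell_mdist => /le_trans; apply.
  rewrite -mulrA ler_pM2l//.
  by have := le_trans tau2 (Asep _ _ Aa Ab ab); lra.
have clow a b : A a -> A b -> `|a - b| <= 2 * K / rho * `|c a - c b|.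
  move=> Aa Ab; have [->|ab] := eqVneq a b; first by rewrite !subrr !normr0 mulr0.
  have [_] := cbi _ _ Aa.1 Ab.1; rewrite ell_mdist.
  have := Asep _ _ Aa Ab ab; rewrite /tau mulrDr.
  have -> : 2 * K / rho * `|c a - c b| = 2 * (K * (`|c a - c b| / rho)) by field; rewrite gt_eqF.
  by move: (K * (_ / rho)) => x; rewrite -!mulrA; lra.
have /choice[h hP] u : exists a, (c @` A) u -> A a /\ c a = u.
  have [[a Aa au]|nu] := pselect ((c @` A) u); first by exists a.
  by exists 0 => /nu.
have L20 : 0 <= 2 * K / rho by rewrite divr_ge0 ?mulr_ge0 ?ltW.
have [||F [FL FA]] := @mcshane_row R _ n (c @` A) h (2 * K / rho) _ L20.
- by exists (c 0), 0.
- move=> u v /hP[Ahu cu] /hP[Ahv cv].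
  by rewrite -{2}cu -{2}cv; exact: clow.
have Fc a : A a -> F (c a) = a.
  move=> Aa; have ca : (c @` A) (c a) by exists a.
  rewrite FA//; have [Ah ch] := hP _ ca; apply/eqP.
  by rewrite -subr_eq0 -normr_le0; have := clow _ _ Ah Aa; rewrite ch subrr normr0 mulr0.
have PL u v : `|E (F u) - E (F v)| <= retract_lip * `|u - v|.
  apply: le_trans (EL _ _) _; apply: le_trans (ler_wpM2l L10 (FL _ _)) _.
  by rewrite /retract_lip le_eqVlt; apply/orP; left; apply/eqP; field; rewrite gt_eqF.
have M0 : 0 <= retract_lip by rewrite /retract_lip !mulr_ge0// ?ltW//; lra.
have dr0 : 0 < delta * rho by rewrite mulr_gt0.
exists (fun u => E (F u)); split => //.
- move=> u ug.
  have Fu : `|F u| <= 2 * K.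
    have := FL u g; rewrite -c0 (Fc 0 A0) subr0 => /le_trans; apply.
    rewrite -mulrA ler_piMr//; first by rewrite ltW// mulr_gt0.
    by rewrite mulrC ler_pdivrMr// mul1r c0.
  have [a Aa Fa] := Anet _ Fu; exists (c a); first exact: cC Aa.1.
  rewrite -(EA _ Aa); apply: le_trans (EL _ _) _.
  apply: le_trans (ler_wpM2l L10 Fa) _.
  have -> : rho * (K + 1) * tau = 2 * retract_lip * (delta * rho).
    by rewrite /tau /retract_lip; ring.
  rewrite -[leRHS]mulrA ler_pM2r// /retract_err.
  have : 4 * retract_lip <= retract_lip * (4 * K * K).
    by rewrite mulrC ler_wpM2l//; lra.
  rewrite mulrDl mul1r mulrDr; lra.
- move=> u Cu ug.
  have [|b b2 ub] := cnet u Cu; first by rewrite ell_mdist distrC.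
  have [a Aa ba] := Anet _ b2; rewrite ell_mdist in ub.
  have bK : K * `|b| <= delta^-1.
    by apply: le_trans Kd2; rewrite ler_pM2l.
  have [+ _] := cbi _ _ bK Aa.1; rewrite ell_mdist => cba.
  have ua : `|u - c a| <= (4 * K * K + 5) * (delta * rho).
    apply: le_trans (ler_distD (c b) _ _) _.
    have : rho * (K * `|b - a| + 2 * delta) <= rho * (K * tau + 2 * delta).
      by rewrite ler_pM2l// lerD2r ler_pM2l.
    rewrite /tau; have -> : rho * (K * (4 * K * delta) + 2 * delta) =
      (4 * K * K + 2) * (delta * rho) by ring.
    move: ub cba; rewrite -mulrA !mulrDl; lra.
  rewrite -mulrA.
  have -> : E (F u) - u = E (F u) - E (F (c a)) + (c a - u).
    by rewrite (Fc _ Aa) (EA _ Aa) addrA subrK.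
  apply: le_trans (ler_normD _ _) _; rewrite (distrC (c a)).
  have := PL u (c a); have := ler_wpM2l M0 ua.
  have -> : retract_err * (delta * rho) = retract_lip * ((4 * K * K + 5) *
    (delta * rho)) + (4 * K * K + 5) * (delta * rho) by rewrite /retract_err; ring.
  by move: ua; move: (_ * (delta * rho)) => x; lra.
Qed.

End retraction.

(** * Pushing a map towards C by local retractions *)

Section bump.
Context {R : realType} (s : R).
Hypothesis s_gt0 : 0 < s.

Definition bump (x : R) : R := Num.max 0 (Num.min 1 (2 - 2 * x / s)).

Lemma bump01 x : 0 <= bump x <= 1.
Proof. by rewrite /bump le_max lexx /= ge_max ler01 ge_min lexx. Qed.

Lemma bump_lip x y : `|bump x - bump y| <= 2 / s * `|x - y|.
Proof.
have s'0 : 0 < s^-1 by rewrite invr_gt0.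
have -> : 2 / s * `|x - y| = `|2 * x / s - 2 * y / s|.
  by rewrite -mulrBl -mulrBr !normrM (gtr0_norm s'0) gtr0_norm// mulrAC.
rewrite /bump; move: (2 * x / s) (2 * y / s) => a b.
have := ler_norm (a - b); have := ler_norm (b - a).
rewrite (distrC b) ler_norml; move: `|a - b| => d.
rewrite /Num.max /Num.min; do !case: ifP; lra.
Qed.

Lemma bump_eq1 x : x <= s / 2 -> bump x = 1.
Proof.
move=> xs; have h : 2 * x / s <= 1 by rewrite ler_pdivrMr//; lra.
by rewrite /bump min_l ?max_r//; lra.
Qed.

Lemma bump_eq0 x : s <= x -> bump x = 0.
Proof.
move=> xs; have h : 2 <= 2 * x / s by rewrite ler_pdivlMr//; lra.
by rewrite /bump max_l// ge_min; apply/orP; right; lra.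
Qed.

End bump.

Section push.
Context {R : realType} {V W : normedModType R}.
Variables (M eps L s s' b : R) (C : set W) (D : set V) (h0 : V -> W).
Variables (act : set V) (cen : V -> W) (P : V -> W -> W).
Hypothesis M0 : 0 <= M.
Hypothesis eps0 : 0 <= eps.
Hypothesis L0 : 0 < L.
Hypothesis s0 : 0 < s.
Hypothesis s'0 : 0 < s'.
Hypothesis s's : s' <= s.
Hypothesis epsL : eps <= L * s'.
Hypothesis D0 : D !=set0.
Hypothesis h0L : forall x y, `|h0 x - h0 y| <= L * `|x - y|.
Hypothesis h0D : forall p, D p -> C (h0 p).
Hypothesis actC : forall v, act v -> C (cen v).
Hypothesis act_near : forall v, act v -> `|h0 v - cen v| <= 6 * (L * s).
Hypothesis P_lip : forall v, act v ->
  forall x y, `|P v x - P v y| <= M * `|x - y|.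
Hypothesis P_into : forall v, act v -> forall u,
  `|u - cen v| <= 4 * b * (L * s) -> exists2 c, C c & `|P v u - c| <= eps.
Hypothesis P_fix : forall v, act v -> forall u, C u ->
  `|u - cen v| <= 2 * b * (L * s) -> `|P v u - u| <= eps.

(* Each colour multiplies by [push_rate] the Lipschitz constant, the displacement
   from [h0] and the distance to [C] of the part [S] treated so far; a single
   parameter [beta] controls all three.  The value is far from optimal. *)
Definition push_rate : R := 8 * M + 11.

(** The offset 8 makes the displacement vanish for [h0], which enters with [beta = 8], and absorbs
    the terms [6 + 1] in [pushed_near_center]. *)
Definition pushed (beta : R) (S : set V) (h : V -> W) := [/\
  forall x y, `|h x - h y| <= beta * L * `|x - y|,
  forall x, `|h x - h0 x| <= (beta - 8) * (L * s),
  forall p, D p -> h p = h0 p &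
  forall q, S q -> exists2 c, C c & `|h q - c| <= beta * eps].

Let epst : eps <= L * s.
Proof. by apply: le_trans epsL _; rewrite ler_pM2l. Qed.

Section one_chart.
Variables (beta : R) (S : set V) (h : V -> W) (psi : V -> R) (v : V).
Hypothesis beta8 : 8 <= beta.
Hypothesis betab : beta <= b.
Hypothesis hP : pushed beta S h.
Hypothesis psi01 : forall x, 0 <= psi x <= 1.
Hypothesis psiL : forall x y, `|psi x - psi y| <= s'^-1 * `|x - y|.
Hypothesis psi_near : forall x, psi x < 1 -> exists2 a, D a & `|x - a| < s'.
Hypothesis actv : act v.

Let t0 : 0 < L * s. Proof. by rewrite mulr_gt0. Qed.

Lemma pushed_near_center q : `|q - v| <= s -> `|h q - cen v| <= (beta - 1) * (L * s).
Proof.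
move=> qv; have [_ hh0 _ _] := hP.
have := hh0 q; have := act_near actv; have := h0L q v.
have : L * `|q - v| <= L * s by rewrite ler_pM2l.
have := ler_distD (h0 q) (h q) (cen v); have := ler_distD (h0 v) (h0 q) (cen v).
rewrite !mulrBl mul1r; lra.
Qed.

Let w q := P v (h q) - h q.

Let w_lip q q' : `|w q - w q'| <= (M + 1) * beta * L * `|q - q'|.
Proof.
have [hL _ _ _] := hP; have := hL q q'; have := P_lip actv (h q) (h q').
have -> : w q - w q' = (P v (h q) - P v (h q')) - (h q - h q').
  by rewrite /w !opprB addrACA [RHS]addrACA; congr (_ + _); exact: addrC.
move=> p1 p2; apply: le_trans (ler_normB _ _) _.
have := ler_wpM2l M0 p2; rewrite -!mulrA mulrDl mul1r; lra.
Qed.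

(** [P v] nearly fixes [c], and passing from [c] to [h q] costs a factor [M] for [P v] and 1 for the
    identity. Hence points already close to [C] are hardly moved. *)
Lemma push_move q c : C c -> `|c - cen v| <= 2 * b * (L * s) ->
  `|w q| <= (M + 1) * `|h q - c| + eps.
Proof.
move=> Cc cv; have := P_fix actv Cc cv; have := P_lip actv (h q) c.
have -> : w q = (P v (h q) - P v c) + (P v c - c) + (c - h q).
  by rewrite (addrA (_ - P v c)) subrK addrA subrK.
have := ler_normD ((P v (h q) - P v c) + (P v c - c)) (c - h q).
have := ler_normD (P v (h q) - P v c) (P v c - c).
rewrite (distrC c); rewrite mulrDl mul1r; lra.
Qed.

Let w_le q : `|q - v| <= s -> `|w q| <= (M + 1) * beta * (L * s).
Proof.
move=> qv; have := pushed_near_center qv => hq.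
have M10 : 0 <= M + 1 by rewrite addr_ge0.
have bt : 0 <= 2 * b * (L * s).
  by rewrite mulr_ge0 ?(ltW t0)// mulr_ge0// (le_trans _ betab)// (le_trans _ beta8).
have := @push_move q (cen v) (actC actv).
rewrite subrr normr0 => /(_ bt) h1; have := ler_wpM2l M10 hq.
have : 0 <= M * (L * s) by rewrite mulr_ge0// ltW.
move: h1 epst; lra.
Qed.

(* [psi] has the large Lipschitz constant [1 / s'], but varies only within [s']
   of [D], where [w] is [O(L s')] because [h] maps [D] into [C]. *)
Let psiw_lip q q' : `|q - v| <= s -> `|q' - v| <= s ->
  `|psi q *: w q - psi q' *: w q'| <= (2 * (M + 1) * beta + 1) * L * `|q - q'|.
Proof.
(* With the larger value of [psi] at [q], the equality [psi q' = 1] forces [psi q = 1] and the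
   cutoffs agree; otherwise [q'] itself is within [s'] of [D]. *)
wlog le : q q' / psi q' <= psi q.
  move=> wl qv q'v; have [le|/ltW le] := leP (psi q') (psi q); first exact: wl.
  by rewrite distrC (distrC q); exact: wl.
move=> qv q'v.
have -> : psi q *: w q - psi q' *: w q' =
    psi q *: (w q - w q') + (psi q - psi q') *: w q'.
  by rewrite (scalerBr _ (w q)) (scalerBl (psi q)) addrA subrK.
have hA : `|psi q *: (w q - w q')| <= (M + 1) * beta * L * `|q - q'|.
  rewrite normrZ (le_trans _ (w_lip q q'))// ler_piMl//.
  by have := psi01 q; rewrite ler_norml; lra.
have hB : `|(psi q - psi q') *: w q'| <= ((M + 1) * beta + 1) * L * `|q - q'|.
  have [psi1|psi1] := leP 1 (psi q').
    have -> : psi q - psi q' = 0 by have := psi01 q; have := psi01 q'; lra.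
    rewrite scale0r normr0 !mulr_ge0//; last exact: ltW.
    by rewrite addr_ge0// mulr_ge0 ?addr_ge0// (le_trans _ beta8).
  have [p Dp q'p] := psi_near psi1.
  have [hL hh0 hD _] := hP.
  have wp : `|w p| <= eps.
    rewrite /w hD//; apply: P_fix => //; first exact: h0D.
    have := act_near actv; have := h0L p q'; have := h0L q' v.
    have : L * `|q' - v| <= L * s by rewrite ler_pM2l.
    have : L * `|p - q'| <= L * s by rewrite ler_pM2l// distrC (le_trans (ltW q'p)).
    have := ler_distD (h0 v) (h0 p) (cen v); have := ler_distD (h0 q') (h0 p) (h0 v).
    have : 2 * 8 * (L * s) <= 2 * b * (L * s).
      by rewrite ler_pM2r// ler_pM2l// (le_trans beta8).
    have := t0; lra.
  have wq' : `|w q'| <= ((M + 1) * beta + 1) * L * s'.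
    have := ler_normD (w q' - w p) (w p); rewrite subrK.
    have := w_lip q' p.
    have : (M + 1) * beta * L * `|q' - p| <= (M + 1) * beta * L * s'.
      rewrite ler_wpM2l ?(ltW q'p)// !mulr_ge0 ?(ltW L0)//.
        by rewrite addr_ge0.
      exact: le_trans beta8.
    move: wp epsL; rewrite mulrDl mulrDl mul1r; lra.
  rewrite normrZ; apply: le_trans (ler_pM _ _ (psiL q q') wq') _ => //.
  by rewrite le_eqVlt; apply/orP; left; apply/eqP; field; rewrite gt_eqF.
by apply: le_trans (ler_normD _ _) _; move: hA hB; lra.
Qed.

Definition push_term q : W := (psi q * bump s `|q - v|) *: w q.

Lemma push_term_out q : s <= `|q - v| -> push_term q = 0.
Proof. by move=> qv; rewrite /push_term bump_eq0// mulr0 scale0r. Qed.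

Lemma push_term_le q : `|q - v| <= s -> `|push_term q| <= `|w q|.
Proof.
move=> qv; rewrite /push_term normrZ ler_piMl//.
have /andP[p0 p1] := psi01 q; have /andP[q0 q1] := bump01 s `|q - v|.
by rewrite normrM (ger0_norm p0) (ger0_norm q0) mulr_ile1.
Qed.

Lemma push_term_bound q : `|push_term q| <= (M + 1) * beta * (L * s).
Proof.
have [qv|qv] := leP `|q - v| s; first exact: le_trans (push_term_le qv) (w_le qv).
rewrite push_term_out ?(ltW qv)// normr0 mulr_ge0 ?(ltW t0)//.
by rewrite mulr_ge0 ?addr_ge0// (le_trans _ beta8).
Qed.

(** By the product rule: [bump] has slope [2 / s], but [w] is [O(L s)] on the ball of radius [s]
    around [v], so this factor too contributes [O(L)]. *)
Lemma push_term_lip q q' : `|push_term q - push_term q'| <=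
  (4 * (M + 1) * beta + 1) * L * `|q - q'|.
Proof.
wlog qv : q q' / `|q - v| <= s.
  move=> wl; have [qv|qv] := leP `|q - v| s; first exact: wl.
  have [q'v|q'v] := leP `|q' - v| s; first by rewrite distrC (distrC q); exact: wl.
  rewrite (push_term_out (ltW qv)) (push_term_out (ltW q'v)) subrr normr0.
  rewrite !mulr_ge0 ?(ltW L0)//.
  by rewrite addr_ge0// !mulr_ge0 ?addr_ge0// (le_trans _ beta8).
pose x q := psi q *: w q.
have termE r : push_term r = bump s `|r - v| *: x r.
  by rewrite /push_term /x scalerA mulrC.
have xq : `|x q| <= (M + 1) * beta * (L * s).
  rewrite /x normrZ (le_trans _ (w_le qv))// ler_piMl//.
  by have := psi01 q; rewrite ler_norml; lra.
have dbump : `|(bump s `|q - v| - bump s `|q' - v|) *: x q| <=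
    2 * (M + 1) * beta * L * `|q - q'|.
  rewrite normrZ.
  have := bump_lip s0 `|q - v| `|q' - v|.
  have := ler_dist_dist (q - v) (q' - v); rewrite opprB addrA subrK => dd bl.
  have {}bl : `|bump s `|q - v| - bump s `|q' - v| | <= 2 / s * `|q - q'|.
    by apply: le_trans bl _; rewrite ler_pM2l ?divr_gt0.
  apply: le_trans (ler_pM _ _ bl xq) _ => //.
  by rewrite le_eqVlt; apply/orP; left; apply/eqP; field; rewrite gt_eqF.
have c0 : 0 <= (2 * (M + 1) * beta + 1) * L * `|q - q'|.
  rewrite !mulr_ge0 ?(ltW L0)// addr_ge0// !mulr_ge0 ?addr_ge0//.
  exact: le_trans beta8.
have tot : 2 * (M + 1) * beta * L * `|q - q'| +
    (2 * (M + 1) * beta + 1) * L * `|q - q'| =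
    (4 * (M + 1) * beta + 1) * L * `|q - q'| by ring.
have [q'v|q'v] := leP `|q' - v| s.
  have -> : push_term q - push_term q' = (bump s `|q - v| - bump s `|q' - v|) *: x q
      + bump s `|q' - v| *: (x q - x q').
    by rewrite !termE (scalerBr _ (x q)) (scalerBl (bump s `|q - v|)) addrA subrK.
  rewrite -tot; apply: le_trans (ler_normD _ _) _; apply: lerD => //.
  rewrite normrZ; apply: le_trans (psiw_lip qv q'v); rewrite ler_piMl//.
  by have := bump01 s `|q' - v|; rewrite ler_norml; lra.
have b0 : bump s `|q' - v| = 0 by rewrite bump_eq0// ltW.
rewrite !termE b0 scale0r subr0 -tot; move: dbump; rewrite b0 subr0; lra.
Qed.

End one_chart.

(* [N] maps a point to the nearest centre of the colour at hand. *)
Definition pushable (N : V -> V) : set V := [set q | [/\ act (N q),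
  `|q - N q| <= s / 2 & forall p, D p -> s' <= `|q - p|]].

Lemma push_rate_ge1 : 1 <= push_rate.
Proof. by rewrite /push_rate; have := M0; lra. Qed.

(** Each point is moved by the retraction of its own centre [N q] only. A pushable point undergoes
    the whole retraction and lands within [eps] of [C]; a point of [S] is already close to [C], so
    [push_move] limits the harm done to it. *)
Lemma push_colour (beta : R) (S : set V) (h : V -> W) (N : V -> V) :
  8 <= beta -> push_rate * beta <= b -> pushed beta S h ->
  (forall q, `|q - N q| <= s) ->
  (forall q q', `|q - N q'| < s -> N q = N q') ->
  exists h', pushed (push_rate * beta) (S `|` pushable N) h'.
Proof.
move=> beta8 Qb hP Ns Neq; have [hL hh0 hD hS] := hP.
have beta0 : 0 <= beta by rewrite (le_trans _ beta8).
have QE : push_rate * beta = 8 * (M * beta) + 11 * beta by rewrite /push_rate; ring.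
have Mb0 : 0 <= M * beta by rewrite mulr_ge0.
have t0 : 0 < L * s by rewrite mulr_gt0.
have betab : beta <= b by move: Qb; rewrite QE; lra.
have [psi [psi01 psiL psiD psi_near]] := lipschitz_cutoff D0 s'0.
pose k v q := push_term h psi v q.
pose e q := if `[< act (N q) >] then k (N q) q else 0.
have kl v : act v -> forall q q', `|k v q - k v q'| <=
    (4 * (M + 1) * beta + 1) * L * `|q - q'|.
  by move=> av q q'; exact: (push_term_lip beta8 betab hP psi01 psiL psi_near av).
(* If the centres differ, [q'] lies outside the open ball around [N q], where the term of [N q]
   vanishes. This bounds [e q] alone; two such bounds give the factor 2 in [eL]. *)
have e_half q q' : N q != N q' -> `|e q| <= (4 * (M + 1) * beta + 1) * L * `|q - q'|.
  move=> NN; rewrite /e; case: asboolP => [aq|_]; last first.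
    by rewrite normr0 !mulr_ge0 ?(ltW L0)// addr_ge0// !mulr_ge0// addr_ge0.
  have := kl _ aq q q'; rewrite {2}/k push_term_out ?subr0// leNgt.
  by apply: contra NN => /Neq ->.
have eL q q' : `|e q - e q'| <= 2 * ((4 * (M + 1) * beta + 1) * L * `|q - q'|).
  have c0 : 0 <= (4 * (M + 1) * beta + 1) * L * `|q - q'|.
    by rewrite !mulr_ge0 ?(ltW L0)// addr_ge0// !mulr_ge0// addr_ge0.
  have [NN|NN] := eqVneq (N q) (N q').
    rewrite /e -NN; case: asboolP => [aq|_]; last by rewrite subrr normr0; lra.
    by have := kl _ aq q q'; lra.
  have := ler_normB (e q) (e q'); have := e_half _ _ NN.
  by rewrite eq_sym in NN; have := e_half _ _ NN; rewrite (distrC q'); lra.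
exists (fun q => h q + e q); split.
- move=> x y; rewrite opprD addrACA (le_trans (ler_normD _ _))//.
  have := hL x y; have := eL x y.
  have : 0 <= (beta - 1) * (L * `|x - y|).
    by rewrite mulr_ge0 ?mulr_ge0 ?(ltW L0)//; lra.
  rewrite QE; lra.
- move=> x; rewrite addrAC (le_trans (ler_normD _ _))//.
  have ex : `|e x| <= (M + 1) * beta * (L * s).
    rewrite /e; case: asboolP => [ax|_]; last first.
      by rewrite normr0 !mulr_ge0 ?(ltW L0) ?(ltW s0)// addr_ge0.
    exact: (push_term_bound beta8 betab hP psi01 ax).
  have := hh0 x; have : 0 <= M * beta * (L * s) by rewrite mulr_ge0// ltW.
  have : 0 <= beta * (L * s) by rewrite mulr_ge0// ltW.
  rewrite QE; lra.
- move=> p Dp; rewrite /e; case: asboolP => [_|_]; last by rewrite addr0 hD.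
  by rewrite /k /push_term psiD// mul0r scale0r addr0 hD.
- have bt2 : beta * eps <= beta * (L * s) by rewrite ler_wpM2l.
  have bb : beta * (L * s) <= b * (L * s) by rewrite ler_pM2r.
  have be0 : 0 <= M * beta * eps by rewrite mulr_ge0.
  have be1 : 8 * eps <= beta * eps by rewrite ler_wpM2r.
  move=> q [Sq|[aq qs far]].
    have [c Cc hc] := hS q Sq; exists c => //.
    have eq : `|e q| <= (M + 1) * `|h q - c| + eps.
      rewrite /e; case: asboolP => [aq|_]; last first.
        by rewrite normr0 addr_ge0// mulr_ge0// addr_ge0.
      apply: le_trans (push_term_le h psi01 (Ns q)) (push_move h aq q Cc _).
      have := pushed_near_center hP aq (Ns q).
      have := ler_distD (h q) c (cen (N q)); rewrite (distrC c (h q)).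
      by have := t0; lra.
    have := ler_normD (h q - c) (e q); rewrite addrAC.
    have := ler_wpM2l M0 hc; rewrite QE; have := eps0; lra.
  (* Both cutoffs equal 1 at [q], so the new map takes the value [P (N q) (h q)] there. *)
  have psi1 : psi q = 1.
    have /andP[_ p1] := psi01 q; apply/eqP; rewrite eq_le p1 leNgt.
    by apply/negP => /psi_near[p Dp]; rewrite ltNge far.
  rewrite /e; case: asboolP => // aq'.
  rewrite /k /push_term psi1 bump_eq1// mul1r scale1r addrC subrK.
  have [|c Cc hc] := P_into aq' (u := h q).
    have : 0 <= beta * (L * s) by rewrite mulr_ge0// ltW.
    by have := pushed_near_center hP aq' (Ns q); have := t0; lra.
  by exists c => //; apply: le_trans hc _; rewrite QE; have := eps0; lra.
Qed.

(** [b] has to dominate the final rate, because the radii on which the retractions are controlled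
    are fixed before the first colour. *)
Lemma push_colours (I : eqType) (N : I -> V -> V) (l : seq I) :
  8 * push_rate ^+ size l <= b ->
  (forall i q, `|q - N i q| <= s) ->
  (forall i q q', `|q - N i q'| < s -> N i q = N i q') ->
  exists h, pushed (8 * push_rate ^+ size l)
    [set q | exists2 i, i \in l & pushable (N i) q] h.
Proof.
move=> + Ns Neq; elim: l => [_|i l IHl hb].
  exists h0; rewrite expr0 mulr1; split => //.
  - move=> x y; apply: le_trans (h0L x y) _; rewrite -mulrA ler_peMl//.
      by rewrite mulr_ge0// ltW.
    by rewrite ler1n.
  - by move=> x; rewrite !subrr mul0r normr0.
  - by move=> q /= [].
have Q0 : 0 <= push_rate by rewrite (le_trans _ push_rate_ge1).
have Ql : 1 <= push_rate ^+ size l by rewrite exprn_ege1// push_rate_ge1.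
have hb' : push_rate * (8 * push_rate ^+ size l) <= b by move: hb; rewrite /= exprS; lra.
have [|h hP] := IHl.
  apply: le_trans hb'; rewrite ler_peMl ?push_rate_ge1//; lra.
have Q8 : 8 <= 8 * push_rate ^+ size l by lra.
have [h' h'P] := push_colour Q8 hb' hP (Ns i) (Neq i).
exists h'; rewrite /= exprS mulrCA.
have [h1 h2 h3 h4] := h'P; split => // q /= [j].
by rewrite in_cons => /orP[/eqP ->|jl] qj; apply: h4; [right|left; exists j].
Qed.

End push.

(** * One refinement step through all colours *)

Section refine.
Context {R : realType} (n : nat).

Lemma retract_lip_ge0 (K : R) : 1 <= K -> 0 <= retract_lip K.
Proof. by move=> K1; rewrite /retract_lip !mulr_ge0//; lra. Qed.

Lemma retract_err_ge0 (K : R) : 1 <= K -> 0 <= retract_err K.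
Proof.
move=> K1; have M0 := retract_lip_ge0 K1.
rewrite /retract_err mulr_ge0//; first lra.
by have : 1 <= K * K by [rewrite mulr_ege1]; lra.
Qed.

(* The exponent is the number of colours: the lattice of mesh [s] is split into
   the translates of [2 s Z^n] by [{0, s}^n]. *)
Definition refine_growth (K : R) : R :=
  8 * push_rate (retract_lip K) ^+ #|{ffun 'I_n -> bool}|.

Lemma refine_growth_ge8 (K : R) : 1 <= K -> 8 <= refine_growth K.
Proof.
move=> K1; rewrite /refine_growth; move: #|_| => N.
by rewrite ler_peMr// exprn_ege1// push_rate_ge1// retract_lip_ge0.
Qed.

Variables (b eta K delta R0 : R) (X C G : set (ell_infty R)).
Hypothesis XCG : GTA n eta K delta R0 X C G.
Hypothesis Kdelta : 4 * K * K <= delta^-1.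
Hypothesis growth_le : refine_growth K <= b.

(** The retractions are taken at radius [rho = 4 * b * (L * s)], large enough for all colours; the
    last hypothesis then makes their error [eps] at most [L * s']. *)
Lemma GTA_refine (h0 : 'rV[R]_n -> ell_infty R) (L s s' : R) (D : set 'rV[R]_n) :
  0 < L -> 0 < s -> 0 < s' -> s' <= s -> D !=set0 ->
  (forall x y, `|h0 x - h0 y| <= L * `|x - y|) ->
  (forall p, D p -> C (h0 p)) ->
  4 * b * (L * s) <= R0 ->
  retract_err K * (4 * b) * delta * s <= s' ->
  exists h, [/\ forall x y, `|h x - h y| <= b * L * `|x - y|,
    forall x, `|h x - h0 x| <= b * (L * s),
    forall p, D p -> h p = h0 p &
    forall q, (exists2 g, G g & `|h0 q - g| <= 5 * (L * s)) ->
      exists2 c, C c & `|h q - c| <= b * L * s'].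
Proof.
move=> L0 s0 s'0 s's D0 h0L h0D scale small.
set rho := 4 * b * (L * s) in scale.
have K1 := GTA_K XCG; have /andP[delta0 _] := GTA_delta XCG.
have b8 : 8 <= b by exact: le_trans (refine_growth_ge8 K1) growth_le.
have M0 := retract_lip_ge0 K1.
have t0 : 0 < L * s by rewrite mulr_gt0.
have rho0 : 0 < rho by rewrite /rho mulr_gt0//; lra.
(* The radius is 6 and not 5 because passing from a point to a centre within [s / 2] changes [h0] by
   up to [L * s / 2]. *)
pose act : set 'rV[R]_n := [set v | exists2 g, G g & `|h0 v - g| <= 6 * (L * s)].
have /choice[cen cenP] v : exists g, act v -> G g /\ `|h0 v - g| <= 6 * (L * s).
  have [[g Gg vg]|nv] := pselect (act v); first by exists g.
  by exists 0 => /nv.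
pose eps := retract_err K * delta * rho.
have /choice[P PP] v : exists P : ell_infty R -> ell_infty R, act v ->
    [/\ forall u w, `|P u - P w| <= retract_lip K * `|u - w|,
    forall u, `|u - cen v| <= rho -> exists2 c, C c & `|P u - c| <= eps &
    forall u, C u -> `|u - cen v| <= rho / 2 -> `|P u - u| <= eps].
  have [av|nv] := pselect (act v); last by exists id => /nv.
  have rhoR : 0 < rho <= R0 by rewrite rho0.
  have [P hP] := GTA_retraction XCG Kdelta (cenP v av).1 rhoR.
  by exists P.
have epsL : eps <= L * s'.
  have -> : eps = L * (retract_err K * (4 * b) * delta * s).
    by rewrite /eps /rho; ring.
  by rewrite ler_pM2l.
have eps0 : 0 <= eps.
  by rewrite /eps mulr_ge0 ?(ltW rho0)// mulr_ge0 ?(ltW delta0)// retract_err_ge0.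
pose N (e : {ffun 'I_n -> bool}) (q : 'rV[R]_n) :=
  row_round (\row_i (if e i then s else 0)) (2 * s) q.
have s20 : 0 < 2 * s by rewrite mulr_gt0.
have s2E : 2 * s / 2 = s by rewrite mulrC mulKf.
have Ns e q : `|q - N e q| <= s by rewrite -[leRHS]s2E row_round_dist.
have Neq e q q' : `|q - N e q'| < s -> N e q = N e q'.
  by move=> h; apply: row_round_eq => //; rewrite s2E.
have [l [lT lb]] : exists l : seq {ffun 'I_n -> bool}, (forall e, e \in l) /\
    8 * push_rate (retract_lip K) ^+ size l <= b.
  exists (enum {ffun 'I_n -> bool}); split; first by move=> e; rewrite mem_enum.
  by move: growth_le; rewrite /refine_growth cardE.
have [b0 b0E] : exists b0, b0 = 8 * push_rate (retract_lip K) ^+ size l by eexists.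
have b0b : b0 <= b by rewrite b0E.
have [|||||h [hL hh0 hD hS]] := @push_colours R _ _ (retract_lip K) eps L s s' b C D
  h0 act cen P M0 eps0 L0 s0 s'0 s's epsL D0 h0L h0D _ _ _ _ _ _ N
  l lb Ns Neq.
- by move=> v /cenP[/(GTA_subGC XCG)].
- by move=> v /cenP[].
- by move=> v /PP[].
- by move=> v /PP[_ into _] u uv; exact: into.
- move=> v /PP[_ _ fix_] u Cu uv; apply: fix_ => //.
  by apply: le_trans uv _; rewrite /rho; lra.
rewrite -b0E in hL hh0 hS.
have {}hL y z : `|h y - h z| <= b * L * `|y - z|.
  by apply: le_trans (hL y z) _; rewrite ler_wpM2r// ler_pM2r.
exists h; split => //.
  by move=> x; apply: le_trans (hh0 x) _; rewrite ler_pM2r//; lra.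
move=> q [g Gg qg].
(* Near [D] the cutoff may prevent pushing, but there [h q] is close to [h p = h0 p], which is
   already in [C]. *)
have [[p Dp qp]|far] := pselect (exists2 p, D p & `|q - p| < s').
  exists (h p); first by rewrite hD//; exact: h0D.
  apply: le_trans (hL q p) _; rewrite ler_pM2l ?ltW//.
  by rewrite mulr_gt0//; lra.
have [e qe] := row_round_near q s0.
have [|c Cc hc] := hS q.
  exists e; first exact: lT.
  split => //; last first.
    by move=> p Dp; rewrite leNgt; apply/negP => qp; apply: far; exists p.
  exists g => //; apply: le_trans (ler_distD (h0 q) _ _) _.
  have := h0L (N e q) q; rewrite (distrC (N e q)).
  have : L * `|q - N e q| <= L * (s / 2) by rewrite ler_pM2l.
  lra.
exists c => //; apply: le_trans hc _.
have : b * eps <= b * (L * s') by rewrite ler_pM2l//; lra.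
have : b0 * eps <= b * eps by rewrite ler_wpM2r.
lra.
Qed.

End refine.

(** * The initial map *)

Lemma exprV4n (R : realType) (m : nat) : (4 ^- m : R) = 2 ^- m * 2 ^- m.
Proof. by rewrite -invfM -exprMn; congr (_ ^+ m)^-1; ring. Qed.

Section dyadic_grid_facts.
Context {R : realType} {n : nat}.
Variables (r : R) (m : nat).
Hypothesis r0 : 0 < r.

Let s : R := 2 ^- m * r.
Let s0 : 0 < s. Proof. by rewrite mulr_gt0// invr_gt0 exprn_gt0. Qed.

Lemma dyadic_grid0 : @dyadic_grid R n r m 0.
Proof.
split; first by move=> i; rewrite mxE lexx ltW.
by exists (fun=> 0) => i; rewrite mxE mulr0.
Qed.

Lemma dyadic_grid_norm (p : 'rV[R]_n) : dyadic_grid r m p -> `|p| <= r.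
Proof.
move=> [pr _]; apply: row_norm_le => [|i]; first exact: ltW.
by have /andP[p0 p1] := pr i; rewrite ger0_norm.
Qed.

Lemma dyadic_grid_sep (p q : 'rV[R]_n) : dyadic_grid r m p -> dyadic_grid r m q ->
  p != q -> s <= `|p - q|.
Proof.
move=> [_ [j pj]] [_ [k qk]] pq.
have [i ji] : exists i, j i != k i.
  apply: contrapT => h; case/negP: pq; apply/eqP/rowP => i.
  rewrite pj qk; have [->//|jk] := eqVneq (j i) (k i).
  by exfalso; apply: h; exists i.
apply: le_trans (row_coord_le (p - q) i); rewrite !mxE pj qk -mulrBr normrM -intrB.
rewrite (mulrC r) -/s gtr0_norm// ler_peMr ?(ltW s0)//.
by rewrite -intr_norm ler1z -gtz0_ge1 normr_gt0 subr_eq0.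
Qed.

Lemma dyadic_grid_near (q : 'rV[R]_n) : cube r q ->
  exists2 p, dyadic_grid r m p & `|q - p| <= s.
Proof.
move=> qr; pose j i := Num.floor (q ord0 i / s).
have js i : s * (j i)%:~R <= q ord0 i < s * (j i)%:~R + s.
  have /andP[] := floor_itv (q ord0 i / s); rewrite -/(j i) intrD.
  by rewrite ler_pdivlMr// ltr_pdivrMr// mulrDl mul1r (mulrC s) => -> ->.
exists (\row_i (s * (j i)%:~R)); last first.
  apply: row_norm_le => [|i]; first exact: ltW.
  by have := js i; rewrite !mxE ler_norml; have := s0; lra.
split; last by exists j => i; rewrite mxE (mulrC r).
move=> i; rewrite mxE; have /andP[q0 q1] := qr i; have /andP[j1 _] := js i.
rewrite (le_trans j1)// andbT mulr_ge0 ?(ltW s0)// ler0z.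
by rewrite /j floor_ge0 divr_ge0// ltW.
Qed.

End dyadic_grid_facts.

Section initial_map.
Context {R : realType} {n : nat}.
Variables (eta K R0 : R) (m : nat) (X C G : set (ell_infty R)).
Hypothesis XCG : GTA n eta K (4 ^- m) R0 X C G.
Hypothesis Km : 2 * K * (K + 1) <= 2 ^+ m.

(* The chart at [x] is taken at the scale [2^-m r] of the mesh rather than [r]:
   its error is then [4^-m] times the mesh, which leaves room for the constant
   [K + 2^-m]. *)
Lemma GTA_initial_map (x : ell_infty R) (r : R) : G x -> 0 < r <= R0 ->
  exists h : 'rV[R]_n -> ell_infty R, [/\
    forall y z, `|h y - h z| <= (K + 2 ^- m) * `|y - z|,
    h 0 = x,
    forall p, dyadic_grid r m p -> C (h p) &
    forall p q, dyadic_grid r m p -> dyadic_grid r m q ->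
      `|p - q| <= (K + 2 ^- m) * `|h p - h q|].
Proof.
move=> Gx /andP[r0 rR0]; have K1 := GTA_K XCG.
have K0 : 0 < K by rewrite (lt_le_trans ltr01).
have KK1 : 1 <= K * K by rewrite mulr_ege1.
have p0 : 0 < 2 ^+ m :> R by rewrite exprn_gt0.
pose w : R := 2 ^- m; have w0 : 0 < w by rewrite invr_gt0.
have Kw : 2 * K * (K + 1) * w <= 1 by rewrite ler_pdivrMr// mul1r.
have Kwl : 4 * w <= 1.
  apply: le_trans Kw; rewrite ler_pM2r//; lra.
have w1 : w <= 1 by lra.
pose s := w * r; have s0 : 0 < s by rewrite mulr_gt0.
have sR0 : 0 < s <= R0.
  by rewrite s0 (le_trans _ rR0)// ler_piMl// ltW.
have pE : (2 ^+ m : R) = w^-1 by rewrite invrK.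
have dE : (4 ^- m : R) = w * w by rewrite exprV4n.
(* Measured in units of the mesh, the grid has radius at most [2^m], whereas the chart is controlled
   up to norm [4^m / K]. *)
have Kp : K * w^-1 <= (4 ^- m)^-1.
  rewrite dE invfM ler_pM2r ?invr_gt0// -pE (le_trans _ Km)//.
  have : 0 <= K * K by rewrite mulr_ge0// ltW.
  lra.
have Kd2 : K * (2 * K) <= (4 ^- m)^-1.
  apply: le_trans Kp; rewrite ler_pM2l// -pE (le_trans _ Km)//; lra.
have [c [c0 cC cbi _]] := GTA_chart_net XCG Kd2 Gx sR0.
pose D := @dyadic_grid R n r m.
have Kp' p : D p -> K * `|s^-1 *: p| <= (4 ^- m)^-1.
  move=> /(dyadic_grid_norm r0) pr; apply: le_trans Kp; rewrite ler_pM2l//.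
  rewrite normrZ gtr0_norm ?invr_gt0// mulrC ler_pdivrMr//.
  by rewrite /s mulrA mulVf ?gt_eqF// mul1r.
have dist (p q : 'rV[R]_n) : `|s^-1 *: p - s^-1 *: q| = `|p - q| / s.
  by rewrite -scalerBr normrZ gtr0_norm ?invr_gt0// mulrC.
have Kw0 : 0 <= K + w by rewrite addr_ge0// ltW.
have up p q : D p -> D q -> `|c (s^-1 *: p) - c (s^-1 *: q)| <= (K + w) * `|p - q|.
  move=> Dp Dq; have [->|pq] := eqVneq p q; first by rewrite !subrr !normr0 mulr0.
  have [+ _] := cbi _ _ (Kp' _ Dp) (Kp' _ Dq); rewrite ell_mdist dist => /le_trans; apply.
  have -> : s * (K * (`|p - q| / s) + 2 * 4 ^- m) = K * `|p - q| + 2 * w * w * s.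
    by rewrite dE; field; rewrite gt_eqF.
  have := dyadic_grid_sep r0 Dp Dq pq; rewrite -/w -/s => ss.
  have : w * (2 * w * s) <= w * `|p - q|.
    by rewrite ler_pM2l// (le_trans _ ss)// ler_piMl ?(ltW s0)//; lra.
  lra.
have lo p q : D p -> D q -> `|p - q| <= (K + w) * `|c (s^-1 *: p) - c (s^-1 *: q)|.
  move=> Dp Dq; have [->|pq] := eqVneq p q; first by rewrite !subrr !normr0 mulr0.
  have [_] := cbi _ _ (Kp' _ Dp) (Kp' _ Dq); rewrite ell_mdist dist.
  have := dyadic_grid_sep r0 Dp Dq pq; rewrite -/w -/s => ss.
  rewrite ler_pdivrMr// dE; move: `|c _ - _| => d.
  have -> : K * (d / s + 2 * (w * w)) * s = K * d + 2 * K * w * w * s.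
    by field; rewrite gt_eqF.
  move: `|p - q| ss => a ss h; have a0 : 0 < a by exact: lt_le_trans ss.
  have Kww : 2 * K * w * w * s <= 2 * K * w * w * a by rewrite ler_pM2l// !mulr_gt0.
  have h1 : a - 2 * K * w * w * a <= K * d by lra.
  have h2 := ler_wpM2l Kw0 h1.
  (* This is [(K + w) * (1 - 2 K w^2) >= K], multiplied by [a]; it follows from
     [2 K (K + 1) w <= 1]. *)
  have h3 : 0 <= w * a * (1 - 2 * K * K * w - 2 * K * w * w).
    have : 2 * K * w * w <= 2 * K * w * 1 by rewrite ler_pM2l// !mulr_gt0.
    by move=> ?; rewrite !mulr_ge0 ?(ltW w0) ?(ltW a0)//; lra.
  by rewrite -(ler_pM2l K0); lra.
have Lip0 : D !=set0 by exists 0; exact: dyadic_grid0.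
have [//|h [hL hD]] := @mcshane_ell R _ D (fun p => c (s^-1 *: p)) (K + w) Lip0 Kw0.
exists h; split => //.
- by rewrite hD ?scaler0//; exact: dyadic_grid0.
- by move=> p Dp; rewrite hD//; apply: cC; exact: Kp'.
- by move=> p q Dp Dq; rewrite !hD//; exact: lo.
Qed.

End initial_map.

(** * The limit of the refinements *)

Section halving_limit.
Context {R : realType}.

Lemma halving_small (e : nat -> R) (d : R) : (forall k, e k.+1 <= e k / 2) ->
  0 < d -> exists k, e k < d.
Proof.
move=> e2 d0; have ek k : 2 ^+ k * e k <= e 0%N.
  elim: k => [|k IHk]; first by rewrite expr0 mul1r.
  apply: le_trans IHk; rewrite exprSr -mulrA ler_pM2l ?exprn_gt0//.
  by have := e2 k; lra.
pose k := (Num.truncn (e 0%N / d)).+1; exists k.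
have p0 : 0 < 2 ^+ k :> R by rewrite exprn_gt0.
rewrite -(ltr_pM2l p0); apply: le_lt_trans (ek k) _.
rewrite -ltr_pdivrMr// (lt_le_trans (truncnS_gt _))// -natrX ler_nat ltnW//.
by rewrite ltn_expl.
Qed.

(** The increments from stage [k] on sum to at most [2 * e k], so every left end [u j - 2 * e j] is
    below every right end [u k + 2 * e k]; the supremum of the left ends is the limit. *)
Lemma halving_limit_real (u e : nat -> R) :
  (forall k, `|u k.+1 - u k| <= e k) -> (forall k, e k.+1 <= e k / 2) ->
  exists l, forall k, `|l - u k| <= 2 * e k.
Proof.
move=> ue e2; have e0 k : 0 <= e k by exact: le_trans (ue k).
have far k j : `|u (k + j)%N - u k| <= 2 * e k - 2 * e (k + j)%N.
  elim: j => [|j IHj]; first by rewrite addn0 !subrr normr0.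
  rewrite addnS; apply: le_trans (ler_distD (u (k + j)%N) _ _) _.
  by have := ue (k + j)%N; have := e2 (k + j)%N; lra.
have nest j k : u j - 2 * e j <= u k + 2 * e k.
  have [jk|/ltnW kj] := leqP j k.
    have := far j (k - j)%N; rewrite subnKC// ler_norml => /andP[h _].
    by have := e0 k; have := e0 j; lra.
  have := far k (j - k)%N; rewrite subnKC// ler_norml => /andP[_ h].
  by have := e0 k; have := e0 j; lra.
pose S := range (fun k => u k - 2 * e k).
exists (sup S) => k; rewrite ler_norml; apply/andP; split.
  have : u k - 2 * e k <= sup S; last lra.
  apply: ub_le_sup; last by exists k.
  by exists (u k + 2 * e k) => _ [j _ <-].
have : sup S <= u k + 2 * e k; last lra.
by apply: ge_sup; [exists (u 0%N - 2 * e 0%N), 0%N|move=> _ [j _ <-]].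
Qed.

Lemma halving_limit_ell (u : nat -> ell_infty R) (e : nat -> R) :
  (forall k, `|u k.+1 - u k| <= e k) -> (forall k, e k.+1 <= e k / 2) ->
  exists l, forall k, `|l - u k| <= 2 * e k.
Proof.
move=> ue e2.
have /choice[l lP] i : exists l, forall k, `|l - u k i| <= 2 * e k.
  apply: (@halving_limit_real (fun k => u k i)) => // k.
  by apply: le_trans (ue k); exact: ell_coord_le (u k.+1 - u k) i.
have lb : l \in @bounded_seq R.
  apply/asboolP; exists (2 * e 0%N + `|u 0%N|) => i.
  rewrite -(subrK (u 0%N i) (l i)) (le_trans (ler_normD _ _))// lerD//.
  exact: ell_coord_le.
by exists (EllInfty lb) => k; apply: ell_norm_le => i; exact: lP.
Qed.

End halving_limit.

Section refined_limit.
Context {R : realType} {n : nat}.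
Variables (b eta K R0 : R) (m : nat) (X C G : set (ell_infty R)).
Let w : R := 2 ^- m.
Hypothesis XCG : GTA n eta K (4 ^- m) R0 X C G.
Hypothesis Km : 2 * K * (K + 1) <= 2 ^+ m.
Hypothesis growth_le : refine_growth n K <= b.
Hypothesis bw : 4 * b * (K + 1) * w <= 1.
Hypothesis err_w : retract_err K * (4 * b) * w <= 1.
Variables (x : ell_infty R) (r : R).
Hypothesis Gx : G x.
Hypothesis rR0 : 0 < r <= R0.

(* [L_k s_k], with [L_k = (K + w) b^k] and [s_k = w^(k+1) r]. *)
Definition level_scale (k : nat) : R := (K + w) * w * r * (b * w) ^+ k.

(** [GTA_refine] is iterated at scales [s k = w * r * w ^+ k] with [s' = s k.+1]. As [b * w <= 1/2],
    the displacements are at least halved at each stage and the maps converge. On the grid nothing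
    ever changes, so there the limit keeps the bounds of the initial map. *)
Lemma GTA_refined_limit : exists (h : nat -> 'rV[R]_n -> ell_infty R)
    (iota : 'rV[R]_n -> ell_infty R), [/\
  forall k y z, `|h k y - h k z| <= (K + w) * b ^+ k * `|y - z|,
  forall k y, `|iota y - h k y| <= 2 * b * level_scale k,
  iota 0 = x,
  [/\ forall p, dyadic_grid r m p -> C (iota p),
    forall p, dyadic_grid r m p -> iota p = h 0%N p &
    forall p q, dyadic_grid r m p -> dyadic_grid r m q ->
      `|p - q| <= (K + w) * `|iota p - iota q|] &
  forall k y, (exists2 g, G g & `|h k y - g| <= 5 * level_scale k) ->
    exists2 c, C c & `|h k.+1 y - c| <= level_scale k.+1].
Proof.
have K1 := GTA_K XCG; have /andP[r0 rR] := rR0.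
have b8 : 8 <= b by exact: le_trans (refine_growth_ge8 n K1) growth_le.
have w0 : 0 < w by rewrite invr_gt0 exprn_gt0.
have bw1 : b * w <= 2^-1.
  have : 1 * (b * w) <= K * (b * w) by rewrite ler_pM2r// mulr_gt0//; lra.
  have : 0 < b * w by rewrite mulr_gt0//; lra.
  by move: bw; lra.
have L0 : 0 < K + w by lra.
have b0 : 0 < b by lra.
have w1 : w <= 1.
  have : 8 * w <= b * w by rewrite ler_pM2r.
  by lra.
have Kd : 4 * K * K <= (4 ^- m)^-1.
  rewrite exprV4n -/w invfM.
  have -> : w^-1 = 2 ^+ m by rewrite /w invrK.
  have KK : 1 <= K * K by rewrite mulr_ege1.
  have P4 : 4 <= 2 ^+ m :> R by apply: le_trans Km; lra.
  have : 0 <= (2 ^+ m - 4) * 2 ^+ m :> R.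
    by rewrite mulr_ge0 ?subr_ge0// (le_trans _ P4).
  by have := Km; lra.
pose D := @dyadic_grid R n r m.
have D0 : D !=set0 by exists 0; exact: dyadic_grid0.
have [h0 [h0L h00 h0C h0D]] := GTA_initial_map XCG Km Gx rR0.
pose inv k (h : 'rV[R]_n -> ell_infty R) :=
  (forall y z, `|h y - h z| <= (K + w) * b ^+ k * `|y - z|) /\
  forall p, D p -> h p = h0 p.
pose s k := w * r * w ^+ k.
have s0 k : 0 < s k by rewrite /s mulr_gt0 ?exprn_gt0// mulr_gt0.
have lsE k : (K + w) * b ^+ k * s k = level_scale k.
  by rewrite /level_scale /s exprMn; ring.
have ls0 k : 0 < level_scale k.
  by rewrite -lsE mulr_gt0 ?s0// mulr_gt0 ?exprn_gt0.
have ls2 k : level_scale k.+1 <= level_scale k / 2.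
  have -> : level_scale k.+1 = level_scale k * (b * w).
    by rewrite /level_scale exprSr mulrA.
  by rewrite ler_pM2l.
have ls_le k : level_scale k <= level_scale 0.
  elim: k => // k IHk; apply: le_trans (ls2 k) _; have := ls0 k; lra.
(* Making the invariant a premise inside the choice yields a total function [nxt], which can be
   iterated. *)
have /choice[nxt nxtP] (kh : nat * ('rV[R]_n -> ell_infty R)) : exists h',
    inv kh.1 kh.2 -> [/\ inv kh.1.+1 h',
    forall y, `|h' y - kh.2 y| <= b * level_scale kh.1 &
    forall y, (exists2 g, G g & `|kh.2 y - g| <= 5 * level_scale kh.1) ->
      exists2 c, C c & `|h' y - c| <= level_scale kh.1.+1].
  case: kh => k h /=; have [[hL hD]|nh] := pselect (inv k h); last by exists h => /nh.
  have Lk : 0 < (K + w) * b ^+ k by rewrite mulr_gt0// exprn_gt0.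
  have [||||h' [h'L h'h h'D h'C]] :=
      GTA_refine (s' := s k.+1) XCG Kd growth_le Lk (s0 k) (s0 k.+1) _ D0 hL.
  - by rewrite /s exprSr mulrA ler_piMr// ltW// -/(s k).
  - by move=> p Dp; rewrite hD//; exact: h0C.
  - rewrite lsE (le_trans _ rR)//.
    have b40 : 0 < 4 * b by lra.
    have : 4 * b * level_scale k <= 4 * b * level_scale 0 by rewrite ler_pM2l.
    move=> /le_trans; apply; rewrite /level_scale expr0 mulr1.
    have : 4 * b * (K + w) * w <= 1.
      by apply: le_trans bw; rewrite ler_pM2r// ler_pM2l// lerD2l.
    move=> /(ler_wpM2r (ltW r0)); lra.
  - rewrite exprV4n -/w /s exprSr mulrA.
    have : 0 <= w * (w * r * w ^+ k) by rewrite mulr_ge0 ?(ltW w0)//; exact: ltW (s0 k).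
    by move=> /ler_wpM2l/(_ _ _ err_w); lra.
  exists h'; split=> //.
  - split; last by move=> p Dp; rewrite h'D// hD.
    move=> y z; have := h'L y z.
    by have -> : b * ((K + w) * b ^+ k) = (K + w) * b ^+ k.+1 by rewrite exprS; ring.
  - by move=> y; have := h'h y; rewrite lsE.
  - move=> y; rewrite -lsE => /h'C[c Cc yc]; exists c => //.
    rewrite -lsE.
    by have -> : (K + w) * b ^+ k.+1 = b * ((K + w) * b ^+ k) by rewrite exprS; ring.
pose fix h k := if k is k'.+1 then nxt (k', h k') else h0.
have hinv k : inv k (h k).
  elim: k => [|k IHk]; last by have [] := nxtP (k, h k) IHk.
  by split=> // y z; rewrite expr0 mulr1.
have hstep k := nxtP (k, h k) (hinv k).
have e2 k : b * level_scale k.+1 <= b * level_scale k / 2.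
  by rewrite -mulrA ler_pM2l.
have /choice[iota iotaP] y : exists l, forall k, `|l - h k y| <= 2 * (b * level_scale k).
  apply: (@halving_limit_ell R (fun k => h k y) (fun k => b * level_scale k)) => // k.
  by have [_ + _] := hstep k; apply.
have iotaD p : D p -> iota p = h0 p.
  move=> Dp; apply/eqP; rewrite -subr_eq0 -normr_le0.
  rewrite leNgt; apply/negP => pos.
  have [k|k] := @halving_small R (fun k => 2 * (b * level_scale k)) _ _ pos.
    by have := e2 k; lra.
  by rewrite ltNge; have := iotaP p k; have [_ ->//] := hinv k => ->.
exists h, iota; split.
- by move=> k; have [] := hinv k.
- by move=> k y; rewrite -mulrA.
- by rewrite iotaD//; exact: dyadic_grid0.
- split=> [p Dp|p Dp|p q Dp Dq]; first by rewrite iotaD//; exact: h0C.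
    by rewrite iotaD.
  by rewrite !iotaD//; exact: h0D.
- by move=> k y near; have [_ _] := hstep k; apply.
Qed.

End refined_limit.

(** * Choice of the scale and Hoelder continuity *)

(** [N] dominates the constants of the first three bounds. From [m (1 - gamma) >= N] comes
    [2^(m (1 - gamma)) >= b], which is the fourth. The fifth follows from it by [8 b + 2 <= 10 b]
    and [m gamma >= m gamma / 2]. *)
Lemma large_scale_parameters (R : realType) (K gamma b e : R) :
  1 <= K -> 0 < gamma < 1 -> 8 <= b -> 0 <= e ->
  exists m0 : nat, forall m, (m0 <= m)%N ->
  [/\ 2 * K * (K + 1) <= 2 ^+ m, 4 * b * (K + 1) * 2 ^- m <= 1,
    e * (4 * b) * 2 ^- m <= 1, b * 2 ^- m <= (2 ^- m) `^ gamma &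
    (4 * b + 1) * (2 * K) * 2 ^- m <= 10 * K * 2 `^ (- (m%:R * gamma / 2))].
Proof.
move=> K1 /andP[g0 g1] b8 e0.
have KK : 1 <= K * K by rewrite mulr_ege1.
have bK : 1 * b <= K * b by rewrite ler_wpM2r//; lra.
have eb : 0 <= e * b by rewrite mulr_ge0//; lra.
pose N := (Num.truncn (2 * K * (K + 1) + 4 * b * (K + 1) + e * (4 * b))).+1.
have NR : 2 * K * (K + 1) + 4 * b * (K + 1) + e * (4 * b) < N%:R by exact: truncnS_gt.
have N0 : 0 < N%:R :> R by rewrite ltr0n.
exists (Num.truncn (N%:R / (1 - gamma))).+1 => m mm.
have mN : N%:R <= m%:R * (1 - gamma).
  rewrite -ler_pdivrMr ?subr_gt0//; apply: le_trans (ltW (truncnS_gt _)) _.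
  by rewrite ler_nat.
have mN1 : N%:R <= m%:R :> R by apply: le_trans mN _; rewrite ler_piMr//; lra.
have PN : N%:R <= 2 ^+ m :> R.
  by apply: le_trans mN1 _; rewrite -natrX ler_nat ltnW// ltn_expl.
have P0 : 0 < 2 ^+ m :> R by rewrite exprn_gt0.
have wE : 2 `^ (- m%:R) = 2 ^- m :> R by rewrite powRN powR_mulrn.
have bw : b * 2 ^- m <= (2 ^- m) `^ gamma :> R.
  have two : 2 `^ (m%:R * (1 - gamma)) = 2 ^+ m * (2 ^- m) `^ gamma :> R.
    rewrite -wE -powRrM -powR_mulrn// -powRD; last by apply/implyP.
    by congr (_ `^ _); ring.
  rewrite ler_pdivrMr// mulrC -two; apply: (@le_trans _ _ (2 `^ N%:R)); last first.
    by rewrite ler_powR//; lra.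
  rewrite powR_mulrn//; apply: (@le_trans _ _ N%:R); first lra.
  by rewrite -natrX ler_nat ltnW// ltn_expl.
split=> //.
- by apply: le_trans PN; lra.
- rewrite ler_pdivrMr// mul1r; apply: le_trans PN; lra.
- rewrite ler_pdivrMr// mul1r; apply: le_trans PN; lra.
have h : b * 2 ^- m <= 2 `^ (- (m%:R * gamma / 2)).
  apply: le_trans bw _; rewrite -wE -powRrM ler_powR//; first lra.
  have : 0 <= m%:R * gamma by rewrite mulr_ge0// ltW.
  lra.
have K0 : 0 < K by lra.
have := ler_wpM2l (ltW K0) h.
have : 0 <= (b - 8) * (K * 2 ^- m).
  by rewrite mulr_ge0 ?subr_ge0// mulr_ge0 ?(ltW K0)// invr_ge0 ltW.
have : 0 <= K * 2 ^- m by rewrite mulr_ge0 ?(ltW K0)// invr_ge0 ltW.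
lra.
Qed.

(** Comparing through stage [k] gives [L b^k |y - z|] plus the tail. When [|y - z|] is comparable to
    [w^k r], both are [O((b w)^k)], and [(b w)^k <= w^(k gamma)]. *)
Lemma hoelder_of_levels (R : realType) (V W : normedModType R)
    (gamma b w L r : R) (h : nat -> V -> W) (iota : V -> W) :
  0 < gamma < 1 -> 0 <= b -> 0 < w <= 2^-1 -> 0 < L -> 0 < r ->
  b * w <= w `^ gamma ->
  (forall k y z, `|h k y - h k z| <= L * b ^+ k * `|y - z|) ->
  (forall k y, `|iota y - h k y| <= 2 * b * (L * w * r * (b * w) ^+ k)) ->
  forall y z, `|y - z| <= r -> `|iota y - iota z| <=
    (4 * b + 1) * L * r * (w ^- 2 / r) `^ gamma * `|y - z| `^ gamma.
Proof.
move=> /andP[g0 g1] b0 /andP[w0 w2] L0 r0 bw hL hi y z.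
have w21 : 1 <= w ^- 2.
  rewrite -[leLHS]invr1 lef_pV2 ?posrE ?exprn_gt0//.
  by rewrite exprn_ile1// ltW//; lra.
have [->|yz] := eqVneq y z.
  rewrite (subrr (iota z)) normr0 mulr_ge0 ?powR_ge0// mulr_ge0 ?powR_ge0//.
  by rewrite mulr_ge0 ?(ltW r0)// mulr_ge0 ?(ltW L0)//; lra.
have wr0 : 0 < w ^- 2 / r by rewrite divr_gt0// invr_gt0 exprn_gt0.
rewrite -mulrA -powRM//; last exact: ltW.
have dyz : 0 < `|y - z| by rewrite normr_gt0 subr_eq0.
move: `|y - z| dyz (fun k => hL k y z) => d d0 hLd dr.
have c0 : 0 <= (4 * b + 1) * L by rewrite mulr_ge0 ?(ltW L0)//; lra.
have wd0 : 0 <= w ^- 2 / r * d by rewrite mulr_ge0// ltW.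
have base k : `|iota y - iota z| <= L * b ^+ k * d + 4 * b * (L * w * r * (b * w) ^+ k).
  apply: le_trans (ler_distD (h k y) _ _) _.
  apply: le_trans (lerD (hi k y) (ler_distD (h k z) _ _)) _.
  have := hi k z; rewrite (distrC (iota z)) => h1; have := hLd k; lra.
have [k0 k0d] : exists k, w ^+ k * (w * r) <= d.
  have [|k kd] := @halving_small R (fun k => w ^+ k * (w * r)) d _ d0.
    move=> k; rewrite exprSr -[leRHS]mulrAC ler_pM2r ?mulr_gt0//.
    by rewrite ler_pM2l// exprn_gt0.
  by exists k; exact: ltW.
have exk : exists k, (fun k => w ^+ k * (w * r) <= d) k by exists k0.
(* A least index [k.+1] means [w^(k+2) r <= d < w^(k+1) r]; stage [k] is used, and the factor [w^-2]
   in the constant pays for the shift. A least index 0 means [w r <= d <= r]. *)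
case: (ex_minnP exk) => -[|k] kd kmin.
  rewrite expr0 mul1r in kd; apply: le_trans (base 0%N) _; rewrite !expr0 !mulr1.
  have dE : d <= r * (w ^- 2 / r * d) `^ gamma.
    apply: (@le_trans _ _ (r * (d / r) `^ gamma)); last first.
      rewrite ler_pM2l//; apply: (ge0_ler_powR (ltW g0)); rewrite ?nnegrE//.
        by rewrite divr_ge0// ltW.
      by rewrite mulrC ler_pM2r// -[leLHS]mul1r ler_pM2r// invr_gt0.
    rewrite -ler_pdivrMl// mulrC ger1_powR ?(ltW g1)//.
    by rewrite divr_gt0//= ler_pdivrMr// mul1r.
  have : L * (w * r) <= L * d by rewrite ler_pM2l.
  have := ler_wpM2l c0 dE; move=> h1 h2.
  have := ler_wpM2l b0 h2; lra.
have wd : d < w ^+ k * (w * r).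
  by rewrite ltNge; apply/negP => /kmin; rewrite ltnn.
apply: le_trans (base k) _.
have E0 : (b * w) ^+ k <= (w ^- 2 / r * d) `^ gamma.
  apply: (@le_trans _ _ ((w ^+ k) `^ gamma)).
    rewrite -[w ^+ k]powR_mulrn ?(ltW w0)// powRAC powR_mulrn ?powR_ge0//.
    by rewrite lerXn2r// nnegrE ?powR_ge0// mulr_ge0// ltW.
  apply: (ge0_ler_powR (ltW g0)); rewrite ?nnegrE ?exprn_ge0 ?(ltW w0)//.
  have -> : w ^+ k = w ^- 2 / r * (w ^+ k.+1 * (w * r)).
    by rewrite (exprS w k); field; rewrite !gt_eqF.
  by rewrite ler_pM2l.
have bk : b ^+ k * d <= (b * w) ^+ k * (w * r).
  by rewrite exprMn -mulrA ler_wpM2l ?exprn_ge0// ltW.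
have h1 := ler_wpM2l (ltW L0) bk.
have Lwr : L * (w * r) <= L * r by rewrite ler_pM2l// ler_piMl ?(ltW r0)//; lra.
have q0 : 0 <= (b * w) ^+ k by rewrite exprn_ge0// mulr_ge0// ltW.
have h2 := ler_wpM2l (mulr_ge0 c0 (ltW r0)) E0.
have b41 : 0 <= 4 * b + 1 by lra.
have h3 := ler_wpM2l b41 (ler_wpM2r q0 Lwr).
lra.
Qed.

(** * The part of the image outside C *)

Section stopping.
Context {R : realType} {n : nat}.
Variables (b eta K R0 : R) (m : nat) (X C G : set (ell_infty R)).
Let w : R := 2 ^- m.
Hypothesis XCG : GTA n.+1 eta K (4 ^- m) R0 X C G.
Hypothesis b8 : 8 <= b.
Hypothesis bw : 4 * b * (K + 1) * w <= 1.
Variables (r : R) (h : nat -> 'rV[R]_n.+1 -> ell_infty R).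
Variable (iota : 'rV[R]_n.+1 -> ell_infty R).
Hypothesis rR0 : 0 < r <= R0.
Let t : nat -> R := level_scale b K m r.
Hypothesis h_lip : forall k y z, `|h k y - h k z| <= (K + w) * b ^+ k * `|y - z|.
Hypothesis iota_h : forall k y, `|iota y - h k y| <= 2 * b * t k.
Hypothesis grid_C : forall p, dyadic_grid r m p -> C (h 0%N p).
Hypothesis near_G : forall k y, (exists2 g, G g & `|h k y - g| <= 5 * t k) ->
  exists2 c, C c & `|h k.+1 y - c| <= t k.+1.

Let K1 : 1 <= K. Proof. exact: GTA_K XCG. Qed.
Let r0 : 0 < r. Proof. by have /andP[] := rR0. Qed.
Let w0 : 0 < w. Proof. by rewrite invr_gt0 exprn_gt0. Qed.
Let b0 : 0 < b. Proof. exact: lt_le_trans b8. Qed.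

Let bw8 : b * w <= 2^-1.
Proof.
have : 1 * (b * w) <= K * (b * w) by rewrite ler_pM2r// mulr_gt0.
have : 0 < b * w by rewrite mulr_gt0.
by move: bw; lra.
Qed.

Let w1 : w <= 1.
Proof. by have : 8 * w <= b * w by [rewrite ler_pM2r]; move: bw8; lra. Qed.

Lemma level_scale_gt0 k : 0 < t k.
Proof.
rewrite /t /level_scale -/w; apply: mulr_gt0; last by rewrite exprn_gt0// mulr_gt0.
by rewrite mulr_gt0// mulr_gt0//; have := w0; have := K1; lra.
Qed.

Lemma level_scale_half k : t k.+1 <= t k / 2.
Proof.
have -> : t k.+1 = t k * (b * w) by rewrite /t /level_scale exprSr mulrA.
by rewrite ler_pM2l// level_scale_gt0.
Qed.

Lemma level_scale_le j k : (j <= k)%N -> t k <= t j.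
Proof.
move=> jk; rewrite -(subnKC jk); elim: (k - j)%N => [|l IHl]; first by rewrite addn0.
rewrite addnS; apply: le_trans IHl.
by have := level_scale_half (j + l); have := level_scale_gt0 (j + l); lra.
Qed.

Lemma level_scale0_le : 4 * b * t 0%N <= r.
Proof.
have : 4 * b * (K + w) * w <= 1.
  apply: le_trans bw; rewrite ler_pM2r// ler_pM2l; last by have := b0; lra.
  by rewrite lerD2l.
move=> /(ler_wpM2r (ltW r0)); rewrite /t /level_scale expr0 -/w; lra.
Qed.

Lemma refined_limit_range y : `|y| <= r -> `|iota y - iota 0| <= 4 * K * r.
Proof.
move=> yr; have := iota_h 0 y; have := iota_h 0 0.
have := h_lip 0 y 0; rewrite expr0 mulr1 subr0 => h1 h2 h3.
have : (K + w) * `|y| <= (K + w) * r.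
  by rewrite ler_wpM2l// addr_ge0 ?(ltW w0)// (le_trans _ K1).
have : 1 * r <= K * r by rewrite ler_pM2r.
have : w * r <= 1 * r by rewrite ler_pM2r.
have := level_scale0_le.
have := ler_distD (h 0%N y) (iota y) (iota 0).
have := ler_distD (h 0%N 0) (h 0%N y) (iota 0).
rewrite (distrC (h 0%N 0)); have := r0; lra.
Qed.

Lemma refined_limit_step y z : `|y - z| <= w * r ->
  `|iota y - iota z| <= (4 * b + 1) * t 0%N.
Proof.
move=> yz; have := iota_h 0 y; have := iota_h 0 z.
have := h_lip 0 y z; rewrite expr0 mulr1 => h1 h2 h3.
have : (K + w) * `|y - z| <= t 0%N.
  rewrite /t /level_scale expr0 mulr1 -/w -mulrA ler_wpM2l//.
  by rewrite addr_ge0 ?(ltW w0)// (le_trans _ K1).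
have := ler_distD (h 0%N y) (iota y) (iota z).
have := ler_distD (h 0%N z) (h 0%N y) (iota z).
rewrite (distrC (h 0%N z)); lra.
Qed.

Lemma refined_limit_in_G y :
  (forall k, exists2 g, G g & `|h k y - g| <= 5 * t k) -> G (iota y).
Proof.
move=> near; have := GTA_closedG XCG; rewrite closure_id => ->.
move=> B /nbhs_ballP[e /= e0 eB].
have [|k ke] := @halving_small R (fun k => (5 + 2 * b) * t k) e _ e0.
  move=> k; rewrite -mulrA ler_wpM2l ?level_scale_half//; have := b0; lra.
have [g Gg hg] := near k; exists g; split => //; apply: eB.
rewrite -ball_normE /=; apply: le_lt_trans ke.
have := ler_distD (h k y) (iota y) g; have := iota_h k y; lra.
Qed.

(** The first stage far from [G] is taken; without one, [iota y] would be a limit of points of [G].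
    The point [c] exists because the previous stage was near [G] or, at stage 0, because a grid
    point is within [w * r] of [y]. *)
Lemma refined_limit_stop y : cube r y -> ~ C (iota y) ->
  exists k c, [/\ C c, `|h k y - c| <= t k &
    forall g, G g -> ~ `|h k y - g| <= 5 * t k].
Proof.
move=> yr nC.
have ex : exists k, `[< ~ exists2 g, G g & `|h k y - g| <= 5 * t k >].
  apply: contrapT => nex; apply: nC; apply: (GTA_subGC XCG).
  apply: refined_limit_in_G => k; apply: contrapT => nk; apply: nex.
  by exists k; apply/asboolP.
case: (ex_minnP ex) => -[|k] /asboolP far kmin.
  have [p Dp yp] := dyadic_grid_near m r0 yr.
  exists 0%N, (h 0%N p); split; first exact: grid_C.
    apply: le_trans (h_lip 0 y p) _.
    rewrite /t /level_scale !expr0 !mulr1 -/w -mulrA ler_wpM2l//.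
    by rewrite addr_ge0 ?(ltW w0)// (le_trans _ K1).
  by move=> g Gg hg; apply: far; exists g.
have [c Cc hc] : exists2 c, C c & `|h k.+1 y - c| <= t k.+1.
  apply: near_G; apply: contrapT => nk.
  by have /kmin : `[< ~ exists2 g, G g & `|h k y - g| <= 5 * t k >]
    by [apply/asboolP]; rewrite ltnn.
by exists k.+1, c; split => // g Gg hg; apply: far; exists g.
Qed.

Lemma refined_limit_content :
  (hausdorff_content n.+1 ((iota @` cube r) `\` C) <=
   ((6 * (2 * b + 1)) ^+ n.+1 / eta)%:E * hausdorff_measure n.+1
     ((cball (iota 0%R) (20 * K * r)%R `&` X) `\` G))%E.
Proof.
have eta0 := GTA_eta XCG.
(* The factor 5 of the stopping condition exceeds [1 + 1], so the ball of radius [t k] around [c]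
   misses [G]. The dilation [2 * b + 1] adds the distances from [iota y] to [h k y] and from there
   to [c]. *)
pose V : set (nat * ell_infty R) := [set i | [/\ C i.2,
  cball i.2 (t i.1) `<=` cball (iota 0) (20 * K * r) &
  forall g, G g -> ~ cball i.2 (t i.1) g]].
apply: (@hausdorff_content_dense_balls R (ell_infty R) n t V) => //.
- by have := b8; lra.
- exact: level_scale_gt0.
- by move=> j k; exact: level_scale_le.
- move=> [k c] [/= Cc ball far]; have tR0 : 0 < t k <= R0.
    rewrite level_scale_gt0/=; have /andP[_] := rR0; apply: le_trans.
    apply: le_trans level_scale0_le; apply: le_trans (level_scale_le (leq0n k)) _.
    by rewrite ler_peMl ?(ltW (level_scale_gt0 0))//; have := b8; lra.
  apply: le_trans (GTA_lower_regular XCG Cc tR0) _.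
  apply: hausdorff_measure_subset => u [cu Xu]; split => //.
  by split; [split => //; exact: ball|move=> Gu; exact: (far u)].
- move=> _ [[y yr <-] nC]; have [k [c [Cc hc far]]] := refined_limit_stop yr nC.
  have ih := iota_h k y.
  have ic : `|iota y - c| <= (2 * b + 1) * t k.
    have := ler_distD (h k y) (iota y) c; lra.
  exists (k, c) => /=; last by rewrite ell_mdist distrC.
  split => //= [u|g Gg]; rewrite /cball/= ell_mdist; last first.
    move=> cg; apply: (far g Gg); have := ler_distD c (h k y) g.
    by have := level_scale_gt0 k; lra.
  rewrite ell_mdist => cu.
  have yr' : `|y| <= r.
    apply: row_norm_le => [|i]; first exact: ltW.
    by have /andP[y0 y1] := yr i; rewrite ger0_norm.
  have := refined_limit_range yr'; have := level_scale0_le.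
  have : (2 * b + 2) * t k <= (2 * b + 2) * t 0%N.
    by rewrite ler_wpM2l ?level_scale_le//; have := b0; lra.
  have : 8 * t 0%N <= b * t 0%N by rewrite ler_pM2r ?level_scale_gt0.
  have : 1 * r <= K * r by rewrite ler_pM2r.
  have := ler_distD (iota y) (iota 0) u; have := ler_distD c (iota y) u.
  rewrite (distrC (iota 0) (iota y)); have := level_scale_gt0 0; lra.
Qed.

End stopping.

(** * Choice of the constants and verification of the conclusions *)

Theorem theorem3p4 (R : realType) (n : nat)
    (K gamma eta : R) (K_ge1 : 1 <= K) (gamma01 : 0 < gamma < 1)
    (eta_gt0 : 0 < eta) :
  exists m0 : nat, forall m : nat, (m0 <= m)%N ->
  exists2 Lambda : R, 0 < Lambda &
  forall (R0 : R) (X C G : set (ell_infty R)),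
    0 < R0 -> closed X -> closed C -> closed G -> G `<=` C -> C `<=` X ->
    GTA n eta K (4 ^- m) R0 X C G ->
  forall (x : ell_infty R) (r : R), G x -> 0 < r <= R0 ->
  exists iota : 'rV[R]_n -> ell_infty R,
    hoelder_map gamma (cube r) iota /\
    (forall y, cube r y -> cball x (20 * K * r) (iota y)) /\
    iota 0 = x /\
    (bilipschitz_map (K + 2 ^- m) (dyadic_grid r m) iota /\
     (forall y, dyadic_grid r m y -> C (iota y))) /\
    (forall y z, cube r y -> cube r z -> `|y - z| <= 2 ^- m * r ->
       `|iota y - iota z| <= 10 * K * 2 `^ (- (m%:R * gamma / 2)) * r) /\
    (hausdorff_content n ((iota @` cube r) `\` C)
       <= Lambda%:E *
          hausdorff_measure n ((cball (iota 0%R) (20 * K * r)%R `&` X) `\` G))%E.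
Proof.
case: n => [|n'].
  (* In dimension 0 the strict bound in [GTA_tangent] contradicts the infinite measure, so [G] has
     no point [x]. *)
  exists 0%N => m _; exists 1 => // R0 X C G _ _ _ _ _ _ XCG x r Gx /andP[r0 rR0].
  have [C' [C'x [_ _]]] := GTA_tangent XCG (r := PosNum r0) Gx rR0.
  by rewrite hausdorff_measure_dim0.
have [b [gb b8]] : exists b, refine_growth n'.+1 K <= b /\ 8 <= b.
  by eexists; split; [exact: lexx|exact: refine_growth_ge8].
have [m0 hm0] := large_scale_parameters K_ge1 gamma01 b8 (retract_err_ge0 K_ge1).
exists m0 => m /hm0[Km bw err_w bw_gamma step_w].
have K0 : 0 < K by rewrite (lt_le_trans ltr01).
have w0 : 0 < 2 ^- m :> R by rewrite invr_gt0 exprn_gt0.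
exists ((6 * (2 * b + 1)) ^+ n'.+1 / eta).
  by rewrite divr_gt0// exprn_gt0//; lra.
move=> R0 X C G R0_gt0 _ _ _ _ _ XCG x r Gx rR0; have /andP[r0 rR] := rR0.
have [h [iota [hL ih i0 [iC ih0 iD] near]]] := GTA_refined_limit XCG Km gb bw err_w Gx rR0.
have gridC p : dyadic_grid r m p -> C (h 0%N p) by move=> Dp; rewrite -ih0//; exact: iC.
have cube_norm (y : 'rV[R]_n'.+1) : cube r y -> `|y| <= r.
  move=> yr; apply: row_norm_le => [|i]; first exact: ltW.
  by have /andP[y0 y1] := yr i; rewrite ger0_norm.
have range := refined_limit_range XCG b8 bw rR0 hL ih.
exists iota; split; [|split; [|split; [|split; [|split]]]].
- have w2 : 0 < (2 ^- m : R) <= 2^-1.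
    rewrite w0 /= lef_pV2 ?posrE ?exprn_gt0// (le_trans _ Km)//.
    by have : 1 <= K * K by [rewrite mulr_ege1]; lra.
  have L0 : 0 < K + 2 ^- m by rewrite addr_gt0.
  have b0 : 0 <= b by lra.
  exists ((4 * b + 1) * (K + 2 ^- m) * r * ((2 ^- m) ^- 2 / r) `^ gamma) => y z yr zr.
  rewrite ell_mdist row_mdist.
  apply: (hoelder_of_levels gamma01 b0 w2 L0 r0 bw_gamma hL) => [k u|].
    exact: ih.
  apply: row_norm_le => [|i]; first exact: ltW.
  by have := yr i; have := zr i; rewrite !mxE ler_norml; lra.
- move=> y /cube_norm/range; rewrite i0 /cball/= ell_mdist distrC => /le_trans; apply.
  by rewrite ler_pM2r// ler_pM2r//; lra.
- by [].
- split; last exact: iC.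
  split=> [p q Dp Dq|]; first by rewrite !ih0// ell_mdist row_mdist; have := hL 0%N p q; rewrite expr0 mulr1.
  (* By [iD], [iota] is injective on the grid, so any choice of preimages is its inverse. *)
  have /choice[g gP] u : exists p, (iota @` dyadic_grid r m) u ->
      dyadic_grid r m p /\ iota p = u.
    have [[p Dp pu]|nu] := pselect ((iota @` dyadic_grid r m) u); first by exists p.
    by exists 0 => /nu.
  exists g; split=> [p Dp|u v /gP[Du iu] /gP[Dv iv]].
    have [Dg ig] : dyadic_grid r m (g (iota p)) /\ iota (g (iota p)) = iota p.
      by apply: gP; exists p.
    apply/eqP; rewrite -subr_eq0 -normr_le0.
    by apply: le_trans (iD _ _ Dg Dp) _; rewrite ig subrr normr0 mulr0.
  by rewrite ell_mdist row_mdist -{2}iu -{2}iv; exact: iD.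
- move=> y z _ _ yz; have := refined_limit_step XCG hL ih yz.
  move=> /le_trans; apply.
  rewrite /level_scale expr0 mulr1.
  have wK : 2 ^- m <= K.
    have : 8 * 2 ^- m <= b * 2 ^- m :> R by rewrite ler_pM2r.
    have : 1 * (b * 2 ^- m) <= K * (b * 2 ^- m) by rewrite ler_pM2r// mulr_gt0//; lra.
    have : 0 < b * 2 ^- m by rewrite mulr_gt0//; lra.
    by move: bw K_ge1; lra.
  have b4 : 0 <= (4 * b + 1) * 2 ^- m by rewrite mulr_ge0 ?(ltW w0)//; lra.
  have h1 : (4 * b + 1) * 2 ^- m * (K + 2 ^- m) <= (4 * b + 1) * 2 ^- m * (2 * K).
    by rewrite ler_wpM2l//; lra.
  have := ler_wpM2r (ltW r0) h1; have := ler_wpM2r (ltW r0) step_w; lra.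
- exact: (refined_limit_content XCG b8 bw rR0 hL ih gridC near).
Qed.
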